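(* Suppose $(M,g(t))$ is a complete $n$-dimensional Ricci flow defined on $[0,T)$, and let $(p,t)\in M\times(0,T)$. Then there exists a constant $a_1=a_1(n)\in(0,1)$, depending only on $n$, such that $$\tfrac14 r_{\mathrm{Rm}}^{-2}(p,t)\le r_{\mathrm{Rm}}^{-2}(\cdot,\cdot)\le 4\,r_{\mathrm{Rm}}^{-2}(p,t)\quad\text{on }\mathcal P(p,t,a_1 r_{\mathrm{Rm}}(p,t)).$$
   Context: A Ricci flow $(M^n,g(t))_{t\in[0,T)}$ is a smooth one-parameter family of $n$-dimensional Riemannian manifolds with $\partial_t g(t)=-2\mathrm{Ric}_{g(t)}$; complete means every $g(t)$ is complete. Parabolic cylinder: $\mathcal P(p,t,r):=B_{g(t)}(p,r)\times(\max\{t-r^2,0\},\min\{t+r^2,T\})$. Riemann scale: $r_{\mathrm{Rm}}(p,t):=\sup\{r>0 \mid |\mathrm{Rm}|<r^{-2}\text{ on }\mathcal P(p,t,r)\}$, with $r_{\mathrm{Rm}}(p,t)=+\infty$ if $(M,g(t))$ is flat for every $t\in[0,T)$. *)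

(* Defs.v *)
From HB Require Import structures.
From mathcomp Require Import all_boot all_order all_algebra.
From mathcomp Require Import all_classical all_reals all_analysis.

Set Implicit Arguments.
Unset Strict Implicit.
Unset Printing Implicit Defensive.

Import Order.TTheory GRing.Theory Num.Theory.
Import numFieldNormedType.Exports.

Local Open Scope classical_set_scope.
Local Open Scope ring_scope.

(** * Smooth maps *)

(* [class_C k U f]: on the open set [U], all iterated directional derivatives
   of [f] of order at most [k] exist and are continuous. *)
Fixpoint class_C (R : realType) (V W : normedModType R) (k : nat)
    (U : set V) (f : V -> W) : Prop :=
  (forall x, U x -> {for x, continuous f}) /\
  if k is k'.+1 then
    forall v : V, (forall x, U x -> derivable f x v) /\ class_C k' U ('D_v f)
  else True.

(* On a set that need not be open (such as a chart times [0, T)), smooth means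
   locally the restriction of a smooth map defined on an open set. *)
Definition smooth_on (R : realType) (V W : normedModType R)
    (A : set V) (f : V -> W) : Prop :=
  forall x, A x -> exists (U : set V) (F : V -> W),
    [/\ open U, U x, (forall k, class_C k U F) &
        forall y, A y -> U y -> f y = F y].

(** * Smooth manifolds *)

(* Coordinates are row vectors. [chart_coord i] and its inverse [chart_param i]
   are total functions, constrained only on [chart_dom i] and on its image. *)
Record manifold (R : realType) (n : nat) := Manifold {
  carrier :> topologicalType ;
  chart : Type ;
  chart_dom : chart -> set carrier ;
  chart_coord : chart -> carrier -> 'rV[R]_n ;
  chart_param : chart -> 'rV[R]_n -> carrier ;
  manifold_hausdorff : hausdorff_space carrier ;
  manifold_second_countable : @second_countable carrier ;
  chart_cover : forall x, exists i, chart_dom i x ;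
  chart_dom_open : forall i, open (chart_dom i) ;
  chart_img_open : forall i, open (chart_coord i @` chart_dom i) ;
  chart_coordK : forall i x, chart_dom i x ->
    chart_param i (chart_coord i x) = x ;
  chart_coord_continuous : forall i,
    {within chart_dom i, continuous (chart_coord i)} ;
  chart_param_continuous : forall i,
    {within chart_coord i @` chart_dom i, continuous (chart_param i)} ;
  chart_transition_smooth : forall i j,
    smooth_on (chart_coord i @` (chart_dom i `&` chart_dom j))
              (chart_coord j \o chart_param i)
}.

Definition chart_img (R : realType) (n : nat) (M : manifold R n)
    (i : chart M) : set 'rV[R]_n := chart_coord i @` chart_dom i.

(* An arbitrary chart around [x]; it is used only to evaluate quantities that
   do not depend on the chart. *)
Definition chart_at (R : realType) (n : nat) (M : manifold R n) (x : M) :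
  chart M := projT1 (cid (chart_cover x)).

(** * Riemannian metrics *)

(* [g i u] is the matrix (g_ab) in the chart [i], at the point with
   coordinates [u]. *)
Definition metric_field (R : realType) (n : nat) (M : manifold R n) : Type :=
  chart M -> 'rV[R]_n -> 'M[R]_n.

(* In [riem_compat], the differential of the change of coordinates sends the
   row vector v to v *m J, whence v g_i v^T = (v J) g_j (v J)^T. *)
Record riemannian_metric (R : realType) (n : nat) (M : manifold R n)
    (g : metric_field M) : Prop := RiemannianMetric {
  riem_smooth : forall i (a b : 'I_n),
    smooth_on (chart_img i) (fun u => g i u a b) ;
  riem_sym : forall i u, chart_img i u -> (g i u)^T = g i u ;
  riem_posdef : forall i u (v : 'rV[R]_n), chart_img i u -> v != 0 ->
    0 < (v *m g i u *m v^T) 0 0 ;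
  riem_compat : forall i j x, chart_dom i x -> chart_dom j x ->
    let J := jacobian (chart_coord j \o chart_param i) (chart_coord i x) in
    g i (chart_coord i x) = J *m g j (chart_coord j x) *m J^T
}.

(** * Riemannian distance *)

Definition piecewise_smooth (R : realType) (n : nat) (M : manifold R n)
    (c : R -> M) : Prop :=
  {within `[0%R, 1%R], continuous c} /\
  exists2 s : seq R, itv_partition 0 1 s &
    forall k, (k < size s)%N -> forall i : chart M,
      smooth_on [set y : R | nth 1 (0 :: s) k <= y <= nth 1 s k /\
                             chart_dom i (c y)]
                (chart_coord i \o c).

(* The derivative is unspecified at 0, at 1 and at the finitely many break
   points, which does not affect the length. *)
Definition speed (R : realType) (n : nat) (M : manifold R n)
    (g : metric_field M) (c : R -> M) (y : R) : R :=
  let i := chart_at (c y) in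
  let v : 'rV[R]_n := derive1 (chart_coord i \o c) y in
  Num.sqrt ((v *m g i (chart_coord i (c y)) *m v^T) 0 0).

Definition curve_length (R : realType) (n : nat) (M : manifold R n)
    (g : metric_field M) (c : R -> M) : \bar R :=
  (\int[lebesgue_measure]_(y in `[0%R, 1%R]) (speed g c y)%:E)%E.

(* The distance is +oo between distinct connected components. *)
Definition rdist (R : realType) (n : nat) (M : manifold R n)
    (g : metric_field M) (x y : M) : \bar R :=
  ereal_inf [set curve_length g c | c in
    [set c : R -> M | [/\ piecewise_smooth c, c 0 = x & c 1 = y]]].

Definition complete_metric (R : realType) (n : nat) (M : manifold R n)
    (g : metric_field M) : Prop :=
  forall u : nat -> M,
    (forall e : R, 0 < e -> exists N, forall j k, (N <= j)%N -> (N <= k)%N ->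
       (rdist g (u j) (u k) < e%:E)%E) ->
    exists x : M, forall e : R, 0 < e -> exists N, forall k, (N <= k)%N ->
       (rdist g (u k) x < e%:E)%E.

(** * Curvature *)

Definition pderiv (R : realType) (n : nat) (f : 'rV[R]_n -> R) (a : 'I_n)
    (u : 'rV[R]_n) : R := 'D_(delta_mx 0 a : 'rV[R]_n) f u.

(* Gamma^c_{ab} = 1/2 g^{cd} (d_a g_{bd} + d_b g_{ad} - d_d g_{ab}) *)
Definition christoffel (R : realType) (n : nat) (M : manifold R n)
    (g : metric_field M) (i : chart M) (c a b : 'I_n) (u : 'rV[R]_n) : R :=
  2^-1 * \sum_(d < n) invmx (g i u) c d *
    (pderiv (fun w => g i w b d) a u + pderiv (fun w => g i w a d) b u
     - pderiv (fun w => g i w a b) d u).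

(* R_{abc}^d, where R(d_a, d_b) d_c = R_{abc}^d d_d and
   R(X, Y) Z = D_X D_Y Z - D_Y D_X Z - D_[X,Y] Z. *)
Definition riem_curv (R : realType) (n : nat) (M : manifold R n)
    (g : metric_field M) (i : chart M) (a b c d : 'I_n) (u : 'rV[R]_n) : R :=
  pderiv (christoffel g i d b c) a u - pderiv (christoffel g i d a c) b u
  + \sum_(e < n) (christoffel g i e b c u * christoffel g i d a e u
                  - christoffel g i e a c u * christoffel g i d b e u).

(* R_{abcd} = g_{de} R_{abc}^e *)
Definition riem_curv_low (R : realType) (n : nat) (M : manifold R n)
    (g : metric_field M) (i : chart M) (a b c d : 'I_n) (u : 'rV[R]_n) : R :=
  \sum_(e < n) g i u d e * riem_curv g i a b c e u.

(* Ric_{bc} = R_{abc}^a, positive on round spheres. *)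
Definition ricci (R : realType) (n : nat) (M : manifold R n)
    (g : metric_field M) (i : chart M) (u : 'rV[R]_n) : 'M[R]_n :=
  \matrix_(b < n, c < n) \sum_(a < n) riem_curv g i a b c a u.

(* |Rm|^2 = g^{aa'} g^{bb'} g^{cc'} g^{dd'} R_{abcd} R_{a'b'c'd'} *)
Definition norm_Rm (R : realType) (n : nat) (M : manifold R n)
    (g : metric_field M) (x : M) : R :=
  let i := chart_at x in
  let u := chart_coord i x in
  let h := invmx (g i u) in
  Num.sqrt (\sum_(a < n) \sum_(b < n) \sum_(c < n) \sum_(d < n)
            \sum_(a' < n) \sum_(b' < n) \sum_(c' < n) \sum_(d' < n)
              h a a' * h b b' * h c c' * h d d' *
              riem_curv_low g i a b c d u * riem_curv_low g i a' b' c' d' u).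

Definition flat (R : realType) (n : nat) (M : manifold R n)
    (g : metric_field M) : Prop :=
  forall i u, chart_img i u -> forall a b c d, riem_curv g i a b c d u = 0.

(** * Ricci flows *)

Definition times (R : realType) (T : \bar R) : set R :=
  [set t | 0 <= t /\ (t%:E < T)%E].

(* At t = 0 the time derivative is one-sided. *)
Record ricci_flow (R : realType) (n : nat) (M : manifold R n) (T : \bar R)
    (g : R -> metric_field M) : Prop := RicciFlow {
  flow_metric : forall t, times T t -> riemannian_metric (g t) ;
  flow_smooth : forall i (a b : 'I_n),
    smooth_on (chart_img i `*` times T : set ('rV[R]_n * R)%type)
              (fun ut => g ut.2 i ut.1 a b) ;
  flow_eq : forall t, times T t -> forall i u, chart_img i u ->
    (s - t)^-1 *: (g s i u - g t i u) @[s --> within (times T) t^']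
      --> - 2 *: ricci (g t) i u
}.

Definition complete_flow (R : realType) (n : nat) (M : manifold R n)
    (T : \bar R) (g : R -> metric_field M) : Prop :=
  forall t, times T t -> complete_metric (g t).

(* The radius is extended since the Riemann scale may be +oo. *)
Definition parabolic_cylinder (R : realType) (n : nat) (M : manifold R n)
    (T : \bar R) (g : R -> metric_field M) (p : M) (t : R) (r : \bar R) :
    set (M * R) :=
  [set qs | (rdist (g t) p qs.1 < r)%E /\
            (Order.max (t%:E - r ^+ 2) 0 < qs.2%:E
               < Order.min (t%:E + r ^+ 2) T)%E].

Definition riemann_scale (R : realType) (n : nat) (M : manifold R n)
    (T : \bar R) (g : R -> metric_field M) (p : M) (t : R) : \bar R :=
  if `[< forall s, times T s -> flat (g s) >] then +oo%E
  else ereal_sup [set r%:E | r in [set r : R | 0 < r /\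
    forall q s, parabolic_cylinder T g p t r%:E (q, s) ->
      norm_Rm (g s) q < r ^- 2]].

(* Main.v *)
From HB Require Import structures.
Require Import Defs.
From mathcomp Require Import all_boot all_order all_algebra.
From mathcomp Require Import all_classical all_reals all_analysis.
From mathcomp Require Import measurable_realfun ring lra.

Set Implicit Arguments.
Unset Strict Implicit.
Unset Printing Implicit Defensive.

Import Order.TTheory GRing.Theory Num.Theory.
Import numFieldNormedType.Exports.

Local Open Scope classical_set_scope.
Local Open Scope ring_scope.

(** Let [r] be the Riemann scale at [(p, t)]. On a parabolic cylinder where
    [|Rm| < rho^-2] one has [|Ric| <= n^2 rho^-2] as a quadratic form, so
    by Gronwall's inequality two metrics [g(s)], [g(t)] with [n^2 |s - t|]
    at most [rho^2 / 4] have ratio at most 3/2 on vectors, at every point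
    of the ball [B_{g(t)}(p, rho)]. A [g(s)]-short curve starting near [p]
    hence stays in this ball: its [g(t)]-length is under control as long as
    it does. With [a1 = 1 / (10 (n + 1))] this gives [P(q, s, r / 2)]
    inside [P(p, t, rho)] for some [rho <= r] close to [r], whence the scale
    at [(q, s)] is at least [r / 2]; and, were the scale at [(q, s)] larger
    than [2 r], it would give [P(p, t, 6 r / 5)] inside [P(q, s, rho)] for
    some [rho > 2 r], contradicting the definition of [r]. When [r] is
    infinite but the flow is not flat (other components of [M]), only the
    finiteness of lengths of curves is needed. *)

(** * Linear algebra *)

Require Import Defs.
From mathcomp Require Import all_boot all_order all_algebra.
From mathcomp Require Import all_classical all_reals all_analysis.
From mathcomp Require Import ring lra.

Set Implicit Arguments.
Unset Strict Implicit.
Unset Printing Implicit Defensive.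

Import Order.TTheory GRing.Theory Num.Theory.
Import numFieldNormedType.Exports.

Local Open Scope classical_set_scope.
Local Open Scope ring_scope.

(** [norm_Rm], [ricci_bound] and [speed] are all read in [chart_at x], a chart that depends on the
    point but not on the time. The metrics at two times are thus compared in the same coordinates,
    and this comparison never changes charts. A change of charts is unavoidable elsewhere:
    [chart_at (c y)] may jump with [y], so the continuity of the speed along a curve is visible only
    in one fixed chart. This calls for the chain rule for transition maps, hence for a proof that
    [class_C] maps, described by directional derivatives, are differentiable. Continuity off the
    break points makes the speed bounded and measurable; lengths are then finite, additive,
    invariant under affine reparametrization and continuous in the end point, on which the
    first-exit argument rests.

    The dimension enters [a1] through time only: times in the small cylinder differ from [t] by less
    than [(a1 r)^2], and the Gronwall exponent [2 n^2 rho^-2 |s - t|] stays below 1/2 once [n a1] is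
    at most 1/10 and [rho] at least 9/10 [r]. *)

Lemma posdef_diagonalize (F : rcfType) (n : nat) (g : 'M[F]_n) : g^T = g ->
  (forall v : 'rV_n, v != 0 -> 0 < (v *m g *m v^T) 0 0) ->
  exists A : 'M[F]_n, A *m g *m A^T = 1%:M.
Proof.
elim: n g => [|n IH] g; first by exists 1%:M; apply/matrixP => -[].
rewrite -[n.+1]/(1 + n)%N in g *; move=> gT gpos.
pose a := ulsubmx g 0 0; pose b := ursubmx g; pose D := drsubmx g.
have ge : g = block_mx a%:M b b^T D.
  rewrite -[LHS]submxK; congr block_mx.
    by rewrite [LHS]mx11_scalar.
  by rewrite -[in LHS]gT trmx_dlsub trmxK || rewrite /b trmx_ursub gT.
have DT : D^T = D by rewrite /D trmx_drsub gT.
have a0 : 0 < a.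
  have := gpos (row_mx 1 0); rewrite ge tr_row_mx mul_row_block mul_row_col.
  rewrite !mul1mx !mul0mx !addr0 trmx1 trmx0 mulmx1 mulmx0 addr0 mxE eqxx mulr1n.
  apply; apply/eqP => /(congr1 (fun M => lsubmx M 0 0)).
  by rewrite row_mxKl !mxE => /eqP; rewrite oner_eq0.
(* Schur complement of the pivot [a]: the congruence by [L] clears the rest of the first row and
   column and leaves [D'], which inherits symmetry and positivity, so that the induction applies.
   Dividing by [sqrt a] then normalizes the pivot. *)
pose D' := D - a^-1 *: (b^T *m b).
have D'T : D'^T = D'.
  by rewrite /D' linearB /= DT linearZ /= trmx_mul trmxK.
pose L : 'M[F]_(1 + n) := block_mx 1%:M 0 (- a^-1 *: b^T) 1%:M.
have Lg : L *m g *m L^T = block_mx a%:M 0 0 D'.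
  rewrite ge /L tr_block_mx !mulmx_block.
  rewrite !trmx1 !trmx0 !mul1mx !mul0mx !mulmx1 !mulmx0 !addr0.
  rewrite linearZ /= trmxK -!scalemxAl -!scalemxAr mul_scalar_mx mul_mx_scalar.
  rewrite !scalerA mulNr mulVf ?gt_eqF // ?mulrN ?mulfV ?gt_eqF //.
  rewrite !scaleN1r !addNr mul0mx scaler0 add0r.
  by rewrite scaleNr addrC.
have [] := IH D' D'T.
  move=> w w0.
  have := gpos (row_mx 0 w *m L).
  rewrite trmx_mul mulmxA -(mulmxA _ L) -(mulmxA _ _ L^T) Lg.
  have -> : row_mx (0 : 'M[F]_1) w *m block_mx (a%:M : 'M[F]_1) 0 0 D' *m
      (row_mx (0 : 'M[F]_1) w)^T = w *m D' *m w^T.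
    rewrite (@mul_row_block _ 1 1 n 1 n) tr_row_mx mul_row_col.
    by rewrite trmx0 !mul0mx !mulmx0 !add0r.
  apply; apply/eqP => /(congr1 rsubmx).
  rewrite mul_row_block row_mxKr mul0mx add0r mulmx1 => w00.
  by rewrite w00 linear0 eqxx in w0.
move=> A' HA'.
pose P : 'M[F]_(1 + n) := block_mx (Num.sqrt a)^-1%:M 0 0 A'.
exists (P *m L).
rewrite trmx_mul mulmxA -(mulmxA _ L) -(mulmxA _ _ L^T) Lg /P tr_block_mx !mulmx_block.
rewrite !trmx0 !mul0mx !mulmx0 !addr0 !add0r !mul0mx HA' tr_scalar_mx -!scalar_mxM.
rewrite -{2}(sqr_sqrtr (ltW a0)).
have s0 : Num.sqrt a != 0 by rewrite gt_eqF // sqrtr_gt0.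
by rewrite expr2 mulKf // mulfV // -scalar_mx_block.
Qed.

(** Packs four indices into one, so that [ricci_form_bound] can interchange whole blocks of four
    sums. *)
Lemma sum4E (V : nmodType) (n : nat) (f : 'I_n -> 'I_n -> 'I_n -> 'I_n -> V) :
  \sum_a \sum_b \sum_c \sum_d f a b c d =
  \sum_(p : 'I_n * 'I_n * 'I_n * 'I_n) f p.1.1.1 p.1.1.2 p.1.2 p.2.
Proof. by rewrite !pair_bigA. Qed.

Lemma prod_sum4 (F : comPzRingType) (n : nat) (f g u w : 'I_n -> F) :
  (\sum_a f a) * (\sum_b g b) * (\sum_c u c) * (\sum_d w d) =
  \sum_a \sum_b \sum_c \sum_d f a * g b * u c * w d.
Proof.
rewrite !mulr_suml; apply: eq_bigr => a _.
rewrite [f a * _]mulr_sumr !mulr_suml; apply: eq_bigr => b _.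
rewrite [f a * g b * _]mulr_sumr !mulr_suml; apply: eq_bigr => c _.
by rewrite mulr_sumr.
Qed.

(* In a frame orthonormal for [g], [|Rm|^2] is the sum of the squares of the
   components, and each of the [n] terms of the trace defining Ric is a
   quadratic form with entries among these components. *)
Lemma ricci_form_bound (F : rcfType) (n : nat) (g : 'M[F]_n)
    (Rm : 'I_n -> 'I_n -> 'I_n -> 'I_n -> F) (v : 'rV[F]_n) :
  g^T = g -> (forall v : 'rV_n, v != 0 -> 0 < (v *m g *m v^T) 0 0) ->
  `|(v *m (\matrix_(b, c) \sum_a \sum_d invmx g a d * Rm a b c d) *m v^T) 0 0| <=
  n%:R ^+ 2 * Num.sqrt (\sum_(a < n) \sum_(b < n) \sum_(c < n) \sum_(d < n)
            \sum_(a' < n) \sum_(b' < n) \sum_(c' < n) \sum_(d' < n)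
              invmx g a a' * invmx g b b' * invmx g c c' * invmx g d d' *
              Rm a b c d * Rm a' b' c' d') * (v *m g *m v^T) 0 0.
Proof.
move=> gT gpos; set h := invmx g.
have [A AgA] := posdef_diagonalize gT gpos.
have uA : A \in unitmx by move: AgA; rewrite -mulmxA => /mulmx1_unit[].
(* The rows of [A] form a [g]-orthonormal frame and the inverse of [g] is [A^T A]: contraction with
   [h] becomes summation over this frame. *)
have hE a a' : h a a' = \sum_k A k a * A k a'.
  have gA : g *m (A^T *m A) = 1%:M.
    by rewrite mulmxA -[LHS](mulKmx uA) !(mulmxA A) AgA mul1mx mulVmx.
  have ug : g \in unitmx by case: (mulmx1_unit gA).
  have -> : h = A^T *m A.
    by rewrite -[RHS](mulKmx ug) gA mulmx1.
  by rewrite mxE; apply: eq_bigr => k _; rewrite mxE.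
pose T k l m o := \sum_a \sum_b \sum_c \sum_d
  A k a * A l b * A m c * A o d * Rm a b c d.
set N2 := (X in Num.sqrt X).
have N2E : N2 = \sum_k \sum_l \sum_m \sum_o T k l m o ^+ 2.
  transitivity (\sum_(p : 'I_n * 'I_n * 'I_n * 'I_n)
     \sum_(q : 'I_n * 'I_n * 'I_n * 'I_n) \sum_k \sum_l \sum_m \sum_o
     (A k p.1.1.1 * A l p.1.1.2 * A m p.1.2 * A o p.2 *
       Rm p.1.1.1 p.1.1.2 p.1.2 p.2) *
     (A k q.1.1.1 * A l q.1.1.2 * A m q.1.2 * A o q.2 *
       Rm q.1.1.1 q.1.1.2 q.1.2 q.2)).
    rewrite /N2 sum4E; apply: eq_bigr => p _.
    rewrite sum4E; apply: eq_bigr => q _.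
    rewrite !hE prod_sum4.
    rewrite !mulr_suml; apply: eq_bigr => k _.
    rewrite !mulr_suml; apply: eq_bigr => l _.
    rewrite !mulr_suml; apply: eq_bigr => m _.
    rewrite !mulr_suml; apply: eq_bigr => o _.
    by ring.
  rewrite [RHS]sum4E.
  under eq_bigr do under eq_bigr do rewrite sum4E.
  under eq_bigr do rewrite exchange_big /=.
  rewrite exchange_big /=; apply: eq_bigr => k _.
  rewrite /T sum4E expr2 mulr_suml; apply: eq_bigr => p _.
  by rewrite mulr_sumr.
have Tle k l m o : `|T k l m o| <= Num.sqrt N2.
  rewrite -sqrtr_sqr; apply: ler_wsqrtr; rewrite N2E !sum4E.
  rewrite (bigD1 (k, l, m, o)) //= lerDl; apply: sumr_ge0 => i _.
  exact: sqr_ge0.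
have [w vE] : exists w, v = w *m A.
  by exists (v *m invmx A); rewrite mulmxKV.
have -> : (v *m g *m v^T) 0 0 = \sum_l w 0 l ^+ 2.
  rewrite vE trmx_mul mulmxA -(mulmxA w) -(mulmxA w) AgA mulmx1 mxE.
  by apply: eq_bigr => l _; rewrite mxE expr2.
pose Q k := \matrix_(b, c) \sum_a \sum_d A k a * A k d * Rm a b c d.
have AQA k l m : (A *m Q k *m A^T) l m = T k l m k.
  rewrite mxE /T exchange_big /=.
  under [RHS]eq_bigr do rewrite exchange_big /=.
  rewrite [RHS]exchange_big /=; apply: eq_bigr => c _.
  rewrite !mxE mulr_suml; apply: eq_bigr => b _.
  rewrite !mxE mulr_sumr mulr_suml; apply: eq_bigr => a _.
  rewrite mulr_sumr mulr_suml; apply: eq_bigr => d _.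
  by ring.
have -> : (v *m (\matrix_(b, c) \sum_a \sum_d h a d * Rm a b c d) *m v^T) 0 0 =
   \sum_k \sum_m \sum_l w 0 l * T k l m k * w 0 m.
  have -> : \matrix_(b, c) \sum_a \sum_d h a d * Rm a b c d = \sum_k Q k.
    apply/matrixP => b c; rewrite summxE mxE.
    under [RHS]eq_bigr do rewrite mxE.
    rewrite [RHS]exchange_big /=; apply: eq_bigr => a _.
    rewrite [RHS]exchange_big /=; apply: eq_bigr => d _.
    by rewrite hE mulr_suml.
  rewrite mulmx_sumr mulmx_suml summxE; apply: eq_bigr => k _.
  rewrite vE trmx_mul mulmxA -(mulmxA w) -(mulmxA w) mxE; apply: eq_bigr => m _.
  rewrite mxE mulr_suml; apply: eq_bigr => l _.
  by rewrite AQA mxE.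
set S := Num.sqrt N2.
(* Each product is split by [|w_l w_m| <= (w_l^2 + w_m^2) / 2]. Summing over [l] and [m] costs one
   factor [n], the trace index [k] another: hence [n^2]. *)
apply: (@le_trans _ _ (\sum_(k < n) \sum_(m < n) \sum_(l < n)
    S * (2^-1 * (w 0 l ^+ 2 + w 0 m ^+ 2)))).
  apply: le_trans (ler_norm_sum _ _ _) _; apply: ler_sum => k _.
  apply: le_trans (ler_norm_sum _ _ _) _; apply: ler_sum => m _.
  apply: le_trans (ler_norm_sum _ _ _) _; apply: ler_sum => l _.
  rewrite 2!normrM mulrAC mulrC.
  apply: ler_pM; [exact: normr_ge0|by rewrite mulr_ge0|exact: Tle|].
  rewrite -(real_normK (num_real (w 0 l))) -(real_normK (num_real (w 0 m))).
  have := sqr_ge0 (`|w 0 l| - `|w 0 m|); nra.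
rewrite sumr_const card_ord.
have -> : \sum_(m < n) \sum_(l < n) S * (2^-1 * (w 0 l ^+ 2 + w 0 m ^+ 2)) =
    n%:R * S * \sum_l w 0 l ^+ 2.
  under eq_bigr do rewrite -mulr_sumr -mulr_sumr big_split /= sumr_const card_ord.
  rewrite -mulr_sumr -mulr_sumr big_split /= sumr_const card_ord.
  rewrite sumrMnl; set s := \sum_(i < n) _; rewrite -(mulr_natl s).
  by field.
by rewrite -[leLHS]mulr_natl expr2 !mulrA.
Qed.

(** * Comparison of the metrics of a flow *)

(** The function [exp(-c x) f(x)] is nonincreasing. Both [f] and [c] may have either sign, so
    [metric_comparison] can also apply this to [- q] with rate [- c], which turns the lower bound on
    the derivative of [q] into one on [q]. *)
Lemma gronwall (R : realType) (f df : R -> R) (a b c : R) : a <= b ->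
  (forall x, x \in `[a, b] -> is_derive x 1 f (df x)) ->
  (forall x, x \in `[a, b] -> df x <= c * f x) ->
  f b <= expR (c * (b - a)) * f a.
Proof.
move=> ab fdf dfle.
pose phi : R -> R := (expR \o (- c \*: id)) * f.
pose dphi x := expR (- c * x) * (df x - c * f x).
have phidphi x : x \in `[a, b] -> is_derive x 1 phi (dphi x).
  move=> xab; have fx := fdf x xab.
  apply: is_derive_eq.
  rewrite /dphi /= /GRing.scale /= mulr1.
  by move: (expR _) => e; ring.
have phic : {within `[a, b], continuous phi}.
  by apply: derivable_within_continuous => x /phidphi [].
have phio x : x \in `]a, b[ -> is_derive x 1 phi (dphi x).
  by move=> /subset_itv_oo_cc; exact: phidphi.
have [y yab E] := MVT_segment ab phio phic.
have phi0 : dphi y <= 0.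
  by rewrite /dphi pmulr_rle0 ?expR_gt0// subr_le0 dfle.
have : phi b <= phi a.
  by rewrite -subr_le0 E mulr_le0_ge0 // subr_ge0.
have phiE x : phi x = expR (- c * x) * f x by [].
rewrite !phiE -(ler_pM2l (expR_gt0 (c * b))) !mulrA -!expRD.
by rewrite mulNr subrr expR0 mul1r mulNr mulrBr.
Qed.

(** At an interior time the limit within [times T] of [flow_eq] is a two-sided limit; it is pushed
    through the continuous linear map sending a matrix [N] to [v N v^T]. *)
Lemma metric_is_derive (R : realType) (n : nat) (M : manifold R n) (T : \bar R)
    (g : R -> metric_field M) (i : chart M) (u v : 'rV[R]_n) (t : R) :
  ricci_flow T g -> 0 < t -> (t%:E < T)%E -> chart_img i u ->
  is_derive t 1 (fun s => (v *m g s i u *m v^T) 0 0)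
    (- 2 * (v *m ricci (g t) i u *m v^T) 0 0).
Proof.
move=> flow t0 tT ui.
have Tt : times T t by split => //; exact: ltW.
have nearT : \forall s \near t, times T s.
  near=> s; split; first by apply/ltW; near: s; exact: lt_nbhsr.
  near: s; case: (T) tT => [T'| |] //=.
    by rewrite lte_fin => tT; near=> s; rewrite lte_fin; near: s; exact: lt_nbhsl.
  by move=> _; near=> s; rewrite ltry.
have cvgs : (h + t) @[h --> 0^'] --> within (times T) t^'.
  move=> A; rewrite /within /= /dnbhs /within /= => HA.
  have {HA} /nbhs0P : \forall s \near t, s != t -> A s.
    near=> s => st; have : s != t -> times T s -> A s by near: s.
    by apply => //; near: s.
  apply: filterS => h Hh h0; change (A (h + t)); rewrite addrC; apply: Hh.
  by rewrite addrC -subr_eq0 addrK.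
have H : h^-1 *: ((v *m g (h + t) i u *m v^T) 0 0 - (v *m g t i u *m v^T) 0 0)
    @[h --> 0^'] --> - 2 * (v *m ricci (g t) i u *m v^T) 0 0.
  have lin (N : 'M[R]_n) : (v *m N *m v^T) 0 0 = \sum_c \sum_b v 0 b * N b c * v 0 c.
    rewrite mxE; apply: eq_bigr => c _; rewrite !mxE mulr_suml.
    by apply: eq_bigr.
  have quadC : continuous (fun N : 'M[R]_n => (v *m N *m v^T) 0 0).
    rewrite (funext lin) => N.
    apply: (@cvg_big R _ +%R 0 xpredT (@add_continuous R) _ (nbhs N) _ _ _
              (nbhs_filter N)) => c _.
    apply: (@cvg_big R _ +%R 0 xpredT (@add_continuous R) _ (nbhs N) _ _ _
              (nbhs_filter N)) => b _.
    by apply: cvgMl; apply: cvgMr; exact: coord_continuous.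
  have := cvg_comp _ _ (cvg_comp _ _ cvgs (flow_eq flow Tt ui)) (quadC _).
  rewrite -scalemxAr -scalemxAl mxE.
  apply: cvg_trans; apply: near_eq_cvg; near=> h => /=.
  by rewrite addrK -scalemxAr -scalemxAl mxE mulmxBr mulmxBl !mxE.
have E : (fun h : R => h^-1 *:
      (((fun s => (v *m g s i u *m v^T) 0 0) \o shift t) (h *: 1)
       - (v *m g t i u *m v^T) 0 0)) =
    (fun h : R => h^-1 *:
      ((v *m g (h + t) i u *m v^T) 0 0 - (v *m g t i u *m v^T) 0 0)).
  by apply/funext => h /=; rewrite /GRing.scale /= mulr1.
split.
  by rewrite /derivable E; apply: cvgP H.
by rewrite /derive E; exact: cvg_lim H.
Unshelve. all: by end_near.
Qed.

(** Raising the last index back, [R_abc^a = g^{ad} R_abcd], brings the trace into the form treated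
    by [ricci_form_bound]. *)
Lemma ricci_bound (R : realType) (n : nat) (M : manifold R n)
    (g : metric_field M) (x : M) (v : 'rV[R]_n) : riemannian_metric g ->
  `|(v *m ricci g (chart_at x) (chart_coord (chart_at x) x) *m v^T) 0 0| <=
    n%:R ^+ 2 * norm_Rm g x *
    (v *m g (chart_at x) (chart_coord (chart_at x) x) *m v^T) 0 0.
Proof.
move=> rg; set i := chart_at x; set u := chart_coord i x.
have xi : chart_dom i x by rewrite /i /chart_at; case: cid.
have ui : chart_img i u by exists x.
have ug : g i u \in unitmx.
  have [A] := posdef_diagonalize (riem_sym rg ui)
    (fun v => @riem_posdef _ _ _ _ rg i u v ui).
  by rewrite -mulmxA => /mulmx1_unit[_]; rewrite unitmx_mul => /andP[].
have -> : ricci g i u = \matrix_(b, c) \sum_a \sum_d invmx (g i u) a d *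
    riem_curv_low g i a b c d u.
  apply/matrixP => b c; rewrite !mxE; apply: eq_bigr => a _.
  under [RHS]eq_bigr do rewrite mulr_sumr.
  rewrite exchange_big /=.
  transitivity (\sum_e (1%:M : 'M[R]_n) a e * riem_curv g i a b c e u).
    rewrite (bigD1 a) //= mxE eqxx mul1r big1 ?addr0 // => e ea.
    by rewrite mxE eq_sym (negbTE ea) mul0r.
  apply: eq_bigr => e _; rewrite -(mulVmx ug) mxE mulr_suml.
  by apply: eq_bigr => d _; rewrite mulrA.
apply: ricci_form_bound; first exact: riem_sym.
by move=> w; exact: riem_posdef.
Qed.

Lemma metric_comparison (R : realType) (n : nat) (M : manifold R n) (T : \bar R)
    (g : R -> metric_field M) (x : M) (v : 'rV[R]_n) (a b K : R) :
  ricci_flow T g -> 0 < a -> a <= b -> (b%:E < T)%E ->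
  (forall s, a <= s <= b -> norm_Rm (g s) x <= K) ->
  let i := chart_at x in let u := chart_coord i x in
  let q s := (v *m g s i u *m v^T) 0 0 in
  let c := 2 * n%:R ^+ 2 * K in
  q b <= expR (c * (b - a)) * q a /\ q a <= expR (c * (b - a)) * q b.
Proof.
move=> flow a0 ab bT HK i u q c.
have xi : chart_dom i x by rewrite /i /chart_at; case: cid.
have ui : chart_img i u by exists x.
pose dq s := - 2 * (v *m ricci (g s) i u *m v^T) 0 0.
have inT s : s \in `[a, b] -> 0 < s /\ (s%:E < T)%E.
  rewrite in_itv /= => /andP[as_ sb]; split; first exact: lt_le_trans as_.
  by apply: le_lt_trans bT; rewrite lee_fin.
have dqP s : s \in `[a, b] -> is_derive s 1 q (dq s).
  by move=> /inT [s0 sT]; exact: (metric_is_derive v flow).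
have dqle s : s \in `[a, b] -> `|dq s| <= c * q s.
  move=> sab; have [s0 sT] := inT s sab.
  have rs : riemannian_metric (g s).
    by apply: (flow_metric flow); split => //; exact: ltW.
  rewrite /dq normrM normrN (ger0_norm (ler0n _ 2)).
  apply: (le_trans (ler_wpM2l (ler0n _ 2) (ricci_bound x v rs))).
  rewrite /c -(mulrA 2) -(mulrA 2); apply: ler_wpM2l => //.
  have q0 : 0 <= q s.
    have [v0|v0] := eqVneq v 0; first by rewrite /q v0 !mul0mx mxE.
    by apply/ltW; apply: (riem_posdef rs).
  apply: ler_wpM2r => //; apply: ler_wpM2l; first exact: sqr_ge0.
  by apply: HK; move: sab; rewrite in_itv.
split.
  apply: gronwall ab dqP _ => s sab; apply: le_trans (dqle s sab); exact: ler_norm.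
have /(_ _) := @gronwall R (- q) (- dq) a b (- c) ab.
have H1 s : s \in `[a, b] -> is_derive s 1 (- q) ((- dq) s).
  by move=> sab; have := dqP s sab => ?; exact: is_deriveN.
have H2 s : s \in `[a, b] -> (- dq) s <= - c * (- q) s.
  move=> sab; rewrite mulrNN; apply: le_trans (dqle s sab).
  by rewrite -normrN ler_norm.
move=> /(_ H1 H2) /=; rewrite mulrN lerN2 => H.
rewrite -(ler_pM2l (expR_gt0 (- c * (b - a)))) mulrA -expRD.
by rewrite mulNr addNr expR0 mul1r -mulNr.
Qed.

(** * Maps of class C^1 *)

Lemma row_norm_le (R : realType) (n : nat) (h : 'rV[R]_n) (c : R) : 0 <= c ->
  (forall j, `|h 0 j| <= c) -> `|h| <= c.
Proof.
move=> c0 hc; rewrite /Num.Def.normr /= mx_normrE.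
by apply: bigmax_le => // -[i j] _ /=; rewrite ord1.
Qed.

Lemma le_row_norm (R : realType) (n : nat) (h : 'rV[R]_n) (j : 'I_n) :
  `|h 0 j| <= `|h|.
Proof.
rewrite [leRHS]/Num.Def.normr /= mx_normrE.
exact: (le_bigmax _ (fun ij => `|h ij.1 ij.2|) (0, j)).
Qed.

Lemma is_derive_line (R : realType) (V W : normedModType R) (f : V -> W)
    (p v : V) (y : R) : derivable f (p + y *: v) v ->
  is_derive y 1 (fun z : R => f (p + z *: v)) ('D_v f (p + y *: v)).
Proof.
move=> df.
have E : (fun h : R => h^-1 *: (((fun z : R => f (p + z *: v)) \o shift y) (h *: 1)
      - f (p + y *: v))) =
    (fun h : R => h^-1 *: ((f \o shift (p + y *: v)) (h *: v) - f (p + y *: v))).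
  apply/funext => h /=; congr (_ *: (f _ - _)).
  by rewrite /= scalerDl [h *: 1]mulr1 addrCA.
split; first by rewrite /derivable E.
by rewrite /derive E.
Qed.

Lemma MVT0 (R : realType) (phi dphi : R -> R) (b : R) :
  (forall y : R, `|y| <= `|b| -> is_derive y 1 phi (dphi y)) ->
  exists2 c, `|c| <= `|b| & phi b - phi 0 = dphi c * b.
Proof.
move=> H; have cont u w : (forall y, y \in `[u, w] -> `|y| <= `|b|) ->
    {within `[u, w], continuous phi}.
  by move=> uw; apply: derivable_within_continuous => y /uw /H [].
have [b0|b0] := leP 0 b.
  have inb y : y \in `[0, b] -> `|y| <= `|b|.
    by rewrite in_itv /= => /andP[y0 yb]; rewrite !ger0_norm.
  have dphi0 y : y \in `]0, b[ -> is_derive y 1 phi (dphi y).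
    by move=> /subset_itv_oo_cc /inb /H.
  have [c cb E] := MVT_segment b0 dphi0 (cont _ _ inb).
  by exists c; [exact: inb|rewrite E subr0].
have inb y : y \in `[b, 0] -> `|y| <= `|b|.
  rewrite in_itv /= => /andP[yb y0].
  by rewrite !ler0_norm ?(ltW b0) // lerN2.
have dphi0 y : y \in `]b, 0[ -> is_derive y 1 phi (dphi y).
  by move=> /subset_itv_oo_cc /inb /H.
have [c cb E] := MVT_segment (ltW b0) dphi0 (cont _ _ inb).
exists c; first exact: inb.
by rewrite -opprB E sub0r mulrN opprK.
Qed.

Lemma differentiable_littleo (R : realType) (V W : normedModType R)
    (f : V -> W) (df : {linear V -> W}) (x : V) : continuous df ->
  (forall eps, 0 < eps -> exists2 r, 0 < r &
    forall h, `|h| < r -> `|f (h + x) - (f x + df h)| <= eps * `|h|) ->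
  differentiable f x.
Proof.
move=> dfc H; have dxf : f \o shift x = cst (f x) + df +o_ 0 id.
  apply/eqaddoP => eps /H[r r0 Hr]; near=> h.
  by apply: Hr; near: h; exact: nbhs0_lt.
by apply/diff_locallyP; rewrite (diff_unique dfc dxf).
Unshelve. all: by end_near.
Qed.

(** The increment from [x] to [x + h] is cut into [n] moves along the axes; the mean value theorem
    handles each move, and continuity of the partial derivatives at [x] makes the error small. *)
Lemma C1_differentiable_scalar (R : realType) (n : nat) (U : set 'rV[R]_n)
    (f : 'rV[R]_n -> R) (x : 'rV[R]_n) : open U -> U x ->
  (forall v y, U y -> derivable f y v) ->
  (forall v, {for x, continuous ('D_v f)}) ->
  differentiable f x.
Proof.
move=> oU Ux df cf.
pose e j : 'rV[R]_n := delta_mx 0 j.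
pose D (h : 'rV[R]_n) : R := \sum_j h 0 j * 'D_(e j) f x.
have D_lin : linear D.
  move=> a u v; rewrite /D /GRing.scale /= mulr_sumr -big_split /=.
  by apply: eq_bigr => j _; rewrite !mxE mulrDl mulrA.
pose DL := GRing.isLinear.Build _ _ _ _ D D_lin.
pose dD : {linear 'rV[R]_n -> R} := HB.pack D DL.
have D_cont : continuous dD.
  move=> h; apply: (@cvg_big R _ +%R 0 xpredT (@add_continuous R) _ (nbhs h) _ _ _
              (nbhs_filter h)) => j _.
  by apply: cvgMl; exact: coord_continuous.
apply: (differentiable_littleo D_cont) => eps eps0.
(* The [n] moves cost [n * d <= eps] times [|h|]; with [n.+1] the number [d] is positive in
   dimension 0 too. *)
pose d := eps / n.+1%:R.
have d0 : 0 < d by rewrite divr_gt0.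
have : \forall y \near x, U y /\ forall j, `|'D_(e j) f x - 'D_(e j) f y| <= d.
  near=> y; split; first by near: y; exact: open_nbhs_nbhs.
  move=> j; move: j; near: y; apply: filter_forall => j.
  by have /cvgrPdist_le := cf (e j); exact.
move=> /nbhs_normP[r /= r0 near_x].
exists r => // h hr.
pose p k : 'rV[R]_n := x + \row_(j < n) (if (j < k)%N then h 0 j else 0).
(* The norm is the maximum norm, so every point of the broken path from [x] to [x + h] stays within
   [|h|] of [x]. *)
have inball k (c : R) (ltkn : (k < n)%N) : `|c| <= `|h 0 (Ordinal ltkn)| ->
    let y := p k + c *: e (Ordinal ltkn) in
    U y /\ forall j, `|'D_(e j) f x - 'D_(e j) f y| <= d.
  move=> ch y; apply: near_x => /=; apply: le_lt_trans hr.
  have -> : x - y = - (\row_j (if (j < k)%N then h 0 j else 0) +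
      c *: e (Ordinal ltkn)).
    by rewrite /y /p opprD addrA opprD addrA subrr sub0r opprD.
  rewrite normrN; apply: row_norm_le => // j; rewrite !mxE eqxx /=.
  have [jk|jk] := ltnP j k.
    have -> : (j == Ordinal ltkn) = false by rewrite -val_eqE /= ltn_eqF.
    by rewrite mulr0 addr0 le_row_norm.
  rewrite add0r; case: eqVneq => _; last by rewrite mulr0 normr0.
  by rewrite mulr1; apply: le_trans ch (le_row_norm _ _).
have step k (ltkn : (k < n)%N) : `|f (p k.+1) - f (p k)
    - h 0 (Ordinal ltkn) * 'D_(e (Ordinal ltkn)) f x| <= d * `|h|.
  set i := Ordinal ltkn.
  have -> : p k.+1 = p k + h 0 i *: e i.
    rewrite /p -addrA; congr (x + _); apply/rowP => j; rewrite !mxE eqxx /=.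
    rewrite ltnS leq_eqVlt -val_eqE /=.
    have [jk|jk] := eqVneq (j : nat) k.
      by rewrite jk ltnn add0r mulr1; congr (h 0 _); exact: val_inj.
    by rewrite mulr0 addr0.
  have [|c cb E] := @MVT0 R (fun z => f (p k + z *: e i))
      (fun z => 'D_(e i) f (p k + z *: e i)) (h 0 i).
    move=> y yh; apply: is_derive_line; apply: df.
    by have [] := inball k y ltkn yh.
  rewrite scale0r addr0 in E; rewrite E [X in X - _]mulrC -mulrBr normrM mulrC.
  apply: ler_pM => //; last exact: le_row_norm.
  by rewrite distrC; have [_ /(_ i)] := inball k c ltkn cb.
have -> : f (h + x) - (f x + dD h) =
    \sum_(i < n) (f (p i.+1) - f (p i) - h 0 i * 'D_(e i) f x).
  rewrite sumrB -(big_mkord xpredT (fun i => f (p i.+1) - f (p i))).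
  rewrite telescope_sumr //.
  have -> : p n = h + x.
    rewrite /p addrC; congr (_ + _); apply/rowP => j.
    by rewrite mxE ltn_ord.
  have -> : p 0%N = x.
    by rewrite /p -[RHS]addr0; congr (_ + _); apply/rowP => j; rewrite !mxE.
  by rewrite -addrA -opprD.
apply: le_trans (ler_norm_sum _ _ _) _.
apply: (@le_trans _ _ (\sum_(i < n) d * `|h|)).
  by apply: ler_sum => -[i lti] _; exact: (step i lti).
rewrite sumr_const card_ord -mulr_natl mulrA; apply: ler_wpM2r => //.
rewrite /d mulrCA ger_pMr // ler_pdivrMr // mul1r ler_nat //.
Unshelve. all: by end_near.
Qed.

Lemma C1_differentiable (R : realType) (n m : nat) (U : set 'rV[R]_n)
    (F : 'rV[R]_n -> 'rV[R]_m) (x : 'rV[R]_n) : open U -> class_C 1 U F -> U x ->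
  differentiable F x.
Proof.
move=> oU [_ dF] Ux.
have -> : F = \sum_(k < m) ( *:%R^~ (delta_mx 0 k : 'rV[R]_m) \o (fun y => F y 0 k)).
  apply/funext => y; rewrite fct_sumE [LHS]row_sum_delta.
  by apply: eq_bigr => k _ /=.
apply: differentiable_sum => k; apply: differentiable_comp => //.
apply: (C1_differentiable_scalar oU Ux).
  by move=> v y Uy; have [/(_ y Uy)/derivable_mxP dFy _] := dF v; exact: dFy.
move=> v; have [dFv [/(_ x Ux) cFv _]] := dF v.
have DE y : U y -> 'D_v (fun y => F y 0 k) y = ('D_v F y) 0 k.
  by move=> Uy; rewrite [in RHS](derive_mx (dFv y Uy)) mxE.
have cFvk := continuous_comp cFv (@coord_continuous _ _ _ 0 k _).
suff : 'D_v (fun y => F y 0 k) y @[y --> x] --> 'D_v (fun y => F y 0 k) x by [].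
rewrite (DE x Ux); apply: cvg_trans cFvk.
apply: near_eq_cvg; first exact: (nbhs_filter x).
have nU : nbhs x U by exact: open_nbhs_nbhs.
by apply: (@filterS _ (nbhs x) (nbhs_filter x) U) nU => y Uy; rewrite /= DE.
Qed.

(** * Speed of curves *)

Lemma differentiable_near_eq (R : realType) (V W : normedModType R)
    (f F : V -> W) (x : V) :
  (\forall y \near x, F y = f y) -> differentiable F x -> differentiable f x.
Proof.
move=> FE dF; have /eqaddoP FO := diff_locally dF.
apply: (differentiable_littleo (diff_continuous dF)) => eps /FO.
have /nbhs0P FE0 := FE.
move=> FO'; have : \forall h \near (0 : V),
    `|(F \o shift x - (cst (F x) + 'd F x)) h| <= eps * `|h| /\ F (x + h) = f (x + h).
  exact: filterI FO' FE0.
move=> /nbhs_normP[r /= r0 Hr].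
exists r => // h hr; have [] := Hr h; first by rewrite /= sub0r normrN.
rewrite /= => + fF; have -> : f x = F x by apply/esym/(nbhs_singleton FE).
by rewrite addrC in fF; rewrite -fF.
Qed.

Section Charts.
Variables (R : realType) (n : nat) (M : manifold R n).
Implicit Types (i j : chart M) (x : M).

Lemma chart_at_dom x : chart_dom (chart_at x) x.
Proof. by rewrite /chart_at; case: cid. Qed.

(** [chart_transition_smooth] controls the transition map on this set only; differentiability at a
    point requires it to be a neighbourhood, which follows from the continuity of
    [chart_param i]. *)
Lemma transition_dom_nbhs i j x : chart_dom i x -> chart_dom j x ->
  nbhs (chart_coord i x) (chart_coord i @` (chart_dom i `&` chart_dom j)).
Proof.
move=> xi xj.
have ui : (chart_coord i @` chart_dom i) (chart_coord i x) by exists x.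
have ni : nbhs (chart_coord i x) (chart_coord i @` chart_dom i).
  by apply: open_nbhs_nbhs; split => //; exact: chart_img_open.
have nj : nbhs (chart_param i (chart_coord i x)) (chart_dom j).
  rewrite chart_coordK //.
  by apply: open_nbhs_nbhs; split => //; exact: chart_dom_open.
have /subspace_continuousP/(_ _ ui _ nj) := @chart_param_continuous _ _ M i.
rewrite /= /within /= => H.
apply: filterS (filterI ni H) => u [[z zi <-]] Hu.
exists z => //; split=> //; rewrite -(chart_coordK zi).
by apply: Hu; exists z.
Qed.

Lemma transition_differentiable i j x : chart_dom i x -> chart_dom j x ->
  differentiable (chart_coord j \o chart_param i) (chart_coord i x).
Proof.
move=> xi xj; have nx := transition_dom_nbhs xi xj.
have [|U [F [oU Ux CF fF]]] :=
    chart_transition_smooth (x := chart_coord i x) (i := i) (j := j).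
  exact: nbhs_singleton nx.
apply: (@differentiable_near_eq _ _ _ _ F); last exact: (C1_differentiable oU (CF 1%N)).
have nU : nbhs (chart_coord i x) U by exact: open_nbhs_nbhs.
by apply: filterS (filterI nx nU) => u [] /fF H /H.
Qed.

(** The chain rule multiplies the velocity by the Jacobian of the transition map, and [riem_compat]
    absorbs this factor into the metric. *)
Lemma speed_chartE (g : metric_field M) (c : R -> M) (y : R) i :
  riemannian_metric g -> {for y, continuous c} -> chart_dom i (c y) ->
  derivable (chart_coord i \o c) y 1 ->
  let v := 'D_1 (chart_coord i \o c) y in
  speed g c y = Num.sqrt ((v *m g i (chart_coord i (c y)) *m v^T) 0 0).
Proof.
move=> rg cc ic dc v; rewrite /speed; set j := chart_at (c y).
have jc : chart_dom j (c y) by exact: chart_at_dom.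
have nic : \forall z \near y, chart_dom i (c z).
  by apply: cc; apply: open_nbhs_nbhs; split => //; exact: chart_dom_open.
set tau := chart_coord j \o chart_param i.
have dtau : differentiable tau (chart_coord i (c y)).
  exact: transition_differentiable.
have -> : derive1 (chart_coord j \o c) y = v *m jacobian tau (chart_coord i (c y)).
  rewrite derive1E (@near_eq_derive _ _ _ _ (tau \o (chart_coord i \o c))); last first.
    by apply: filterS nic => z zi; rewrite /tau /= chart_coordK.
  have /derivable1_diffP dc' := dc.
  rewrite deriveE; last exact: differentiable_comp.
  by rewrite diff_comp //= /jacobian mul_rV_lin1 /v deriveE.
rewrite (riem_compat rg ic jc) /=; congr (Num.sqrt (_ 0 0)).
by rewrite trmx_mul !mulmxA.
Qed.

End Charts.

Lemma within_continuous_interior (T U : topologicalType) (A : set T)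
    (f : T -> U) (x : T) :
  {within A, continuous f} -> A° x -> {for x, continuous f}.
Proof.
move=> /subspace_continuousP cf Ax P /(cf x (nbhs_singleton Ax)).
rewrite /= /within /= => H.
by apply: filterS (filterI Ax H) => y [Ay]; apply.
Qed.

Lemma smooth_on_continuous (R : realType) (V W : normedModType R) (A : set V)
    (f : V -> W) (x : V) : open A -> A x -> smooth_on A f -> {for x, continuous f}.
Proof.
move=> oA Ax /(_ x Ax)[U [F [oU Ux CF fF]]].
have [cF _] := CF 0%N.
have nAU : nbhs x (A `&` U) by apply: open_nbhs_nbhs; split => //; exact: openI.
suff : f y @[y --> x] --> f x by [].
rewrite (fF x Ax Ux); apply: cvg_trans (cF x Ux).
apply: near_eq_cvg; apply: filterS nAU => y [Ay Uy].
by rewrite fF.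
Qed.

Section Curves.
Variables (R : realType) (n : nat) (M : manifold R n).
Implicit Types (g : metric_field M) (c : R -> M) (A : set R).

Definition smooth_piece c A := forall i : chart M,
  smooth_on [set y | A y /\ chart_dom i (c y)] (chart_coord i \o c).

Lemma smooth_piece_derivable c (A : set R) (y : R) (i : chart M) :
  {within A, continuous c} -> smooth_piece c A -> A° y -> chart_dom i (c y) ->
  derivable (chart_coord i \o c) y 1.
Proof.
move=> cc sc Ay iy.
have [U [F [oU Uy CF cF]]] := sc i y (conj (nbhs_singleton Ay) iy).
have [_ /(_ 1)[dF _]] := CF 1%N.
have cy : {for y, continuous c} by exact: within_continuous_interior cc Ay.
have nU : nbhs y U by exact: open_nbhs_nbhs.
have ni : \forall z \near y, chart_dom i (c z).
  by apply: cy; apply: open_nbhs_nbhs; split => //; exact: chart_dom_open.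
have nE : \forall z \near y, F z = (chart_coord i \o c) z.
  by apply: filterS (filterI (filterI nU ni) Ay) => z [[Uz iz] Az]; rewrite cF.
by apply: near_eq_derivable nE _; exact: dF.
Qed.

(* Up to the end points of a smooth piece the speed is given, in a fixed chart,
   by a continuous function. *)
Lemma speed_local_model g c A (y0 : R) : riemannian_metric g -> A y0 ->
  {within A, continuous c} -> smooth_piece c A ->
  exists2 G : R -> R, {for y0, continuous G} &
    \forall y \near y0, A° y -> speed g c y = Num.sqrt (G y).
Proof.
move=> rg Ay0 cc sc; set i := chart_at (c y0).
have iy0 : chart_dom i (c y0) by exact: chart_at_dom.
have [U [F [oU Uy0 CF cF]]] := sc i y0 (conj Ay0 iy0).
have [cF0 /(_ 1)[_ [cdF _]]] := CF 1%N.
have Fy0 : F y0 = chart_coord i (c y0) by rewrite -cF.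
(* [F] is smooth across [y0] even when [y0] is an end point of [A], where the curve may have no
   two-sided derivative; hence [G] is continuous at [y0]. *)
pose G y := ('D_1 F y *m g i (F y) *m ('D_1 F y)^T) 0 0.
have nUy0 : nbhs y0 U by exact: open_nbhs_nbhs.
exists G.
  have GE y : G y = \sum_b \sum_a 'D_1 F y 0 a * g i (F y) a b * 'D_1 F y 0 b.
    rewrite /G mxE; apply: eq_bigr => b _; rewrite !mxE mulr_suml.
    by apply: eq_bigr.
  have cD k : {for y0, continuous (fun y => 'D_1 F y 0 k)}.
    exact: (continuous_comp (cdF y0 Uy0) (@coord_continuous _ _ _ 0 k _)).
  have cg a b : {for y0, continuous (fun y => g i (F y) a b)}.
    apply: (@continuous_comp _ _ _ F (fun u => g i u a b) y0 (cF0 y0 Uy0)).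
    have Fimg : chart_img i (F y0) by rewrite Fy0; exists (c y0).
    exact: (@smooth_on_continuous _ _ R _ _ _ (@chart_img_open _ _ M i) Fimg
              (@riem_smooth _ _ _ _ rg i a b)).
  rewrite (funext GE) => y.
  apply: (@cvg_big R _ +%R 0 xpredT (@add_continuous R) _ (nbhs y0) _ _ _
              (nbhs_filter y0)) => b _.
  apply: (@cvg_big R _ +%R 0 xpredT (@add_continuous R) _ (nbhs y0) _ _ _
              (nbhs_filter y0)) => a _.
  by apply: cvgM; [apply: cvgM|]; [exact: cD|exact: cg|exact: cD].
have ndom : \forall y \near y0, A y -> chart_dom i (c y).
  have /subspace_continuousP/(_ y0 Ay0 (chart_dom i)) := cc.
  by apply; apply: open_nbhs_nbhs; split => //; exact: chart_dom_open.
apply: filterS (filterI nUy0 ndom) => y [Uy iy] Ay.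
have {}iy : chart_dom i (c y) by apply: iy; exact: nbhs_singleton.
have cy : {for y, continuous c} by exact: within_continuous_interior cc Ay.
have nU : nbhs y U by exact: open_nbhs_nbhs.
have ni : \forall z \near y, chart_dom i (c z).
  by apply: cy; apply: open_nbhs_nbhs; split => //; exact: chart_dom_open.
have nE : \forall z \near y, F z = (chart_coord i \o c) z.
  by apply: filterS (filterI (filterI nU ni) Ay) => z [[Uz iz] Az]; rewrite cF.
have dc := smooth_piece_derivable cc sc Ay iy.
rewrite (speed_chartE rg cy iy dc) -(near_eq_derive _ nE).
by rewrite /G (nbhs_singleton nE).
Qed.

Lemma speed_continuous_at g c A (y0 : R) : riemannian_metric g -> A° y0 ->
  {within A, continuous c} -> smooth_piece c A ->
  {for y0, continuous (speed g c)}.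
Proof.
move=> rg Ay0 cc sc.
have [G cG GE] := speed_local_model rg (nbhs_singleton Ay0) cc sc.
have nA : nbhs y0 A° by exact: nbhs_interior.
have nE : \forall y \near y0, Num.sqrt (G y) = speed g c y.
  by apply: filterS (filterI nA GE) => y [Ay] <-.
suff : speed g c y @[y --> y0] --> speed g c y0 by [].
rewrite -(nbhs_singleton nE).
apply: cvg_trans (continuous_comp cG (@sqrt_continuous R _)).
exact: near_eq_cvg.
Qed.

Lemma speed_locally_bounded g c A (y0 : R) : riemannian_metric g -> A y0 ->
  {within A, continuous c} -> smooth_piece c A ->
  exists B : R, \forall y \near y0, A° y -> speed g c y <= B.
Proof.
move=> rg Ay0 cc sc.
have [G cG GE] := speed_local_model rg Ay0 cc sc.
exists (Num.sqrt (G y0) + 1).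
have cS := continuous_comp cG (@sqrt_continuous R _).
have /cvgrPdist_le/(_ 1 ltr01) nS := cS.
apply: filterS (filterI GE nS) => y [GEy /= +] Ay; rewrite (GEy Ay).
by rewrite ler_distlC => /andP[_].
Qed.

End Curves.

(** * Affine changes of variable *)

Section AffineSmooth.
Variables (R : realType) (W : normedModType R) (al be : R).

Let aff (y : R) : R := al * y + be.

Lemma affine_continuous : continuous aff.
Proof.
by move=> y; apply: cvgD; [apply: cvgMr; exact: cvg_id|exact: cvg_cst].
Qed.

(** An identity between difference quotients, before any limit is taken: [derive_affine] is thus an
    equality of functions on the whole line, as the induction in [class_C_affine] requires. *)
Lemma affine_quotient (F : R -> W) (x v : R) :
  (fun h : R => h^-1 *: (((F \o aff) \o shift x) (h *: v) - (F \o aff) x)) =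
  (fun h : R => h^-1 *: ((F \o shift (aff x)) (h *: (al * v)) - F (aff x))).
Proof.
apply/funext => h; rewrite /= /aff; congr (_ *: (F _ - _)).
by rewrite /GRing.scale /=; ring.
Qed.

Lemma derivable_affine (F : R -> W) (x v : R) :
  derivable F (aff x) (al * v) -> derivable (F \o aff) x v.
Proof. by rewrite /derivable affine_quotient. Qed.

Lemma derive_affine (F : R -> W) (v : R) :
  'D_v (F \o aff) = 'D_(al * v) F \o aff.
Proof. by apply/funext => x; rewrite /derive affine_quotient. Qed.

Lemma class_C_affine (k : nat) (U : set R) (F : R -> W) :
  class_C k U F -> class_C k (aff @^-1` U) (F \o aff).
Proof.
elim: k F => [|k IH] F [cF dF]; split=> //.
- by move=> x Ux; apply: continuous_comp; [exact: affine_continuous|exact: cF].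
- by move=> x Ux; apply: continuous_comp; [exact: affine_continuous|exact: cF].
move=> v; have [dFv CF] := dF (al * v); split.
  by move=> x Ux; apply: derivable_affine; exact: dFv.
by rewrite derive_affine; exact: IH.
Qed.

Lemma smooth_on_affine (A : set R) (f : R -> W) :
  smooth_on A f -> smooth_on (aff @^-1` A) (f \o aff).
Proof.
move=> sf x Ax; have [U [F [oU Ux CF fF]]] := sf _ Ax.
exists (aff @^-1` U), (F \o aff); split => //.
- by apply: open_comp => // y _; exact: affine_continuous.
- by move=> k; exact: class_C_affine.
- by move=> y Ay Uy /=; exact: fF.
Qed.

End AffineSmooth.

Lemma smooth_onW (R : realType) (V W : normedModType R) (A B : set V)
    (f g : V -> W) : A `<=` B -> (forall x, A x -> f x = g x) ->
  smooth_on B g -> smooth_on A f.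
Proof.
move=> AB fg sg x Ax; have [U [F [oU Ux CF gF]]] := sg x (AB _ Ax).
by exists U, F; split=> // y Ay Uy; rewrite fg // gF //; exact: AB.
Qed.

(** The walk stops at the first partition point that is at least [b]. Its predecessor lies below [b]
    and not strictly between [a] and [b], hence is at most [a]. *)
Lemma partition_piece (R : realDomainType) (d x : R) (s : seq R) (a b : R) :
  x < last x s -> x <= a -> a <= b -> b <= last x s ->
  (forall z, z \in s -> ~~ (a < z < b)) ->
  exists2 k, (k < size s)%N & nth d (x :: s) k <= a /\ b <= nth d s k.
Proof.
elim: s x => [|z s IH] x /= xl xa ab bl nz; first by rewrite ltxx in xl.
have [bz|zb] := leP b z; first by exists 0%N.
have za : z <= a.
  by have := nz z (mem_head _ _); rewrite zb andbT -leNgt.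
have [||k ks [ka bk]] := IH z _ za ab bl.
- exact: lt_le_trans bl.
- by move=> w ws; apply: nz; rewrite inE ws orbT.
by exists k.+1.
Qed.

(** * Restriction, reparametrization and concatenation of curves *)

Section Curves.
Variables (R : realType) (n : nat) (M : manifold R n).
Implicit Types (g : metric_field M) (c : R -> M) (S : seq R).

(* Piecewise smoothness with possible breaks at the points of [S], on an
   arbitrary segment: stable under restriction, which only enlarges the
   irrelevant part of [S]. *)
Definition smooth_curve c S (l r : R) : Prop :=
  {within `[l, r], continuous c} /\
  forall a b, l <= a -> a <= b -> b <= r -> (forall z, z \in S -> ~~ (a < z < b)) ->
    smooth_piece c [set y | a <= y <= b].

Lemma smooth_curveW c S l r l' r' : l <= l' -> r' <= r ->
  smooth_curve c S l r -> smooth_curve c S l' r'.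
Proof.
move=> ll rr [cc sc]; split.
  apply: continuous_subspaceW cc => y /=; rewrite !in_itv /= => /andP[ly yr].
  by rewrite (le_trans ll ly) (le_trans yr rr).
by move=> a b la ab br; apply: sc => //; [exact: le_trans la|exact: le_trans rr].
Qed.

Lemma piecewise_smooth_curve c : piecewise_smooth c ->
  exists S, smooth_curve c S 0 1.
Proof.
move=> [cc [s [_ /eqP sl] sc]]; exists s; split=> // a b a0 ab b1 nz i.
have sl0 : 0 < last 0 s by rewrite sl.
have bl : b <= last 0 s by rewrite sl.
have [k ks [ka bk]] := partition_piece 1 sl0 a0 ab bl nz.
apply: (smooth_onW _ _ (sc k ks i)) => // y [/andP[ay yb] iy]; split=> //.
by rewrite (le_trans ka ay) (le_trans yb bk).
Qed.

Lemma smooth_curve_piecewise c S : smooth_curve c S 0 1 -> piecewise_smooth c.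
Proof.
move=> [cc sc]; split=> //.
(* [itv_partition] wants a strictly increasing sequence ending at 1, so the breaks are restricted to
   the open interval, freed of repetitions and sorted, and 1 is appended. *)
pose w := sort <=%O (undup [seq z <- S | 0 < z < 1]).
have memw z : (z \in w) = (z \in S) && (0 < z < 1).
  by rewrite mem_sort mem_undup mem_filter andbC.
have pw : path <%O 0 (rcons w 1).
  rewrite rcons_path lt_path_sortedE sort_lt_sorted undup_uniq andbT.
  apply/andP; split.
    by apply/allP => z; rewrite memw => /and3P[].
  have := mem_last 0 w; rewrite inE memw => /predU1P[-> //|].
  by move=> /and3P[].
exists (rcons w 1); first by split=> //; rewrite last_rcons.
move=> k kw i; set a := nth 1 (0 :: _) k; set b := nth 1 (rcons w 1) k.
have so : sorted <%O (0 :: rcons w 1) by [].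
have bE : b = nth 1 (0 :: rcons w 1) k.+1 by [].
have ltab : a < b.
  rewrite bE /a (lt_sorted_ltn_nth 1 so) ?inE //= ltnS //.
  exact: ltnW.
have mem01 z : z \in 0 :: rcons w 1 -> 0 <= z <= 1.
  rewrite inE mem_rcons inE memw => /predU1P[->|/predU1P[->|/and3P[_ z0 z1]]].
  - by rewrite lexx ler01.
  - by rewrite lexx ler01.
  - by rewrite !ltW.
have /andP[a0 _] : 0 <= a <= 1.
  by apply/mem01/mem_nth; rewrite /= ltnS; exact: ltnW.
have /andP[_ b1] : 0 <= b <= 1 by apply/mem01; rewrite bE; apply: mem_nth.
apply: (sc a b a0 (ltW ltab) b1) => z zS; apply/negP => /andP[az zb].
have zw : z \in 0 :: rcons w 1.
  rewrite inE mem_rcons inE memw zS (le_lt_trans a0 az) (lt_le_trans zb b1).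
  by rewrite !orbT.
have zn : z = nth 1 (0 :: rcons w 1) (index z (0 :: rcons w 1)) by rewrite nth_index.
move: az zb; rewrite bE zn /a.
rewrite !(lt_sorted_ltn_nth 1 so) ?inE ?index_mem //=; last first.
  by rewrite ltnS ltnW.
by move=> k1; rewrite ltnS leqNgt k1.
Qed.

Lemma smooth_curve_affine c S l r (al be l' r' : R) : al != 0 ->
  (forall y, l' <= y <= r' -> l <= al * y + be <= r) ->
  smooth_curve c S l r ->
  smooth_curve (fun y => c (al * y + be)) [seq (z - be) / al | z <- S] l' r'.
Proof.
move=> al0 lr [cc sc]; split.
  apply/subspace_continuousP => y; rewrite /= in_itv /= => lyr.
  have /subspace_continuousP/(_ (al * y + be)) := cc.
  rewrite /= in_itv /= (lr y lyr) => /(_ isT) cy P /cy; rewrite /within /= => nP.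
  have {}nP := @affine_continuous R al be y _ nP.
  apply: (@filterS _ (nbhs y) (nbhs_filter y) _ _ _ nP) => z /= H.
  by rewrite in_itv /= => /lr ?; apply: H; rewrite in_itv.
move=> a b la ab br nz i.
have key (a' b' : R) : (forall y, a <= y <= b -> a' <= al * y + be <= b') ->
    l <= a' -> a' <= b' -> b' <= r -> (forall z, z \in S -> ~~ (a' < z < b')) ->
    smooth_on [set y | a <= y <= b /\ chart_dom i (c (al * y + be))]
      (chart_coord i \o (fun y => c (al * y + be))).
  move=> abE la' ab' br' nz'.
  have := smooth_on_affine (al := al) (be := be) (sc a' b' la' ab' br' nz' i).
  apply: smooth_onW => // y [yab iy] /=; split=> //; exact: abE.
have /andP[la' lar] : l <= al * a + be <= r by apply: lr; rewrite la (le_trans ab br).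
have /andP[lb' lbr] : l <= al * b + be <= r by apply: lr; rewrite br (le_trans la ab).
have nz' z : z \in S -> ~~ (a < (z - be) / al < b).
  by move=> zS; apply: nz; apply/mapP; exists z.
(* A negative slope exchanges the images of [a] and [b]; it occurs when a curve is reversed to prove
   the symmetry of the distance. *)
move: al0; rewrite neq_lt => /orP[al0|al0].
  apply: (key (al * b + be) (al * a + be)) => //.
  - by move=> y /andP[ay yb]; rewrite !lerD2r !ler_nM2l // yb.
  - by rewrite lerD2r ler_nM2l.
  - move=> z /nz'; apply: contra => /andP[bz za].
    rewrite ltr_ndivlMr // ltr_ndivrMr // ltrBlDr ltrBrDr.
    by rewrite mulrC za mulrC bz.
apply: (key (al * a + be) (al * b + be)) => //.
- by move=> y /andP[ay yb]; rewrite !lerD2r !ler_pM2l // ay.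
- by rewrite lerD2r ler_pM2l.
- move=> z /nz'; apply: contra => /andP[az zb].
  rewrite ltr_pdivlMr // ltr_pdivrMr // ltrBlDr ltrBrDr.
  by rewrite mulrC az mulrC zb.
Qed.

Lemma smooth_curve_concat c1 c2 S1 S2 l m r : l <= m -> m <= r -> c1 m = c2 m ->
  smooth_curve c1 S1 l m -> smooth_curve c2 S2 m r ->
  smooth_curve (fun y => if y <= m then c1 y else c2 y) (m :: S1 ++ S2) l r.
Proof.
move=> lm mr c12 [cc1 sc1] [cc2 sc2]; set c := (fun y => _).
have cE1 y : y <= m -> c y = c1 y by rewrite /c => ->.
have cE2 y : m <= y -> c y = c2 y.
  by rewrite le_eqVlt => /predU1P[<-|my]; rewrite /c ?lexx // leNgt my.
split.
  have -> : `[l, r]%classic = `[l, m]%classic `|` `[m, r]%classic.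
    apply/seteqP; split=> y; rewrite /= !in_itv /=.
      by move=> /andP[-> ->]; rewrite andbT /=; exact/orP/le_total.
    by case=> /andP[ly yr]; rewrite ?ly ?yr ?(le_trans lm ly) ?(le_trans yr mr).
  apply: withinU_continuous; try exact: itv_closed.
    apply: subspace_eq_continuous cc1 => y; rewrite inE /= in_itv /= => /andP[_ ym].
    by rewrite /from_subspace /= cE1.
  apply: subspace_eq_continuous cc2 => y; rewrite inE /= in_itv /= => /andP[my _].
  by rewrite /from_subspace /= cE2.
move=> a b la ab br nz i.
have [bm|mb] := leP b m.
  have nz1 z : z \in S1 -> ~~ (a < z < b).
    by move=> zS; apply: nz; rewrite inE mem_cat zS orbT.
  apply: smooth_onW (sc1 a b la ab bm nz1 i) => y [/andP[ay yb]].
    by rewrite /= ay yb cE1 // (le_trans yb).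
  by rewrite /= cE1 // (le_trans yb).
have ma : m <= a.
  by have := nz m (mem_head _ _); rewrite mb andbT -leNgt.
have nz2 z : z \in S2 -> ~~ (a < z < b).
  by move=> zS; apply: nz; rewrite inE mem_cat zS !orbT.
apply: smooth_onW (sc2 a b ma ab br nz2 i) => y [/andP[ay yb]].
  by rewrite /= ay yb cE2 // (le_trans ma).
by rewrite /= cE2 // (le_trans ma).
Qed.

End Curves.

(** * Integrability of the speed *)

Lemma finite_gap (R : realDomainType) (S : seq R) (y0 : R) :
  exists2 e, 0 < e & forall z, z \in S -> z != y0 -> e <= `|z - y0|.
Proof.
elim: S => [|w S [e e0 He]]; first by exists 1.
have [->|wy] := eqVneq w y0.
  exists e => // z; rewrite inE => /predU1P[->|/He //]; by rewrite eqxx.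
exists (Num.min e `|w - y0|); first by rewrite lt_min e0 normr_gt0 subr_eq0.
move=> z; rewrite inE => /predU1P[->|zS] zy; rewrite ge_min.
  by rewrite lexx orbT.
by rewrite He.
Qed.

Lemma measurable_seq (R : realType) (s : seq R) :
  measurable ([set` s] : set (measurableTypeR R)).
Proof.
apply: countable_measurable; first by move=> x; exact: measurable_set1.
exact: finite_set_countable (finite_seq s).
Qed.

(** At break points the speed is an uncontrolled value, but every function is measurable on a finite
    set. *)
Lemma measurable_fun_seq (R : realType) (s : seq R) (f : R -> R) :
  measurable_fun ([set` s] : set (measurableTypeR R)) f.
Proof.
elim: s => [|z s IH].
  have -> : [set` [::]] = set0 :> set R by apply/seteqP; split.
  exact: measurable_fun_set0.
have -> : [set` z :: s] = [set z] `|` [set` s].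
  apply/seteqP; split => w /=; rewrite inE.
    by move=> /predU1P[->|ws]; [left|right].
  by move=> [->|->]; rewrite ?eqxx ?orbT.
apply/measurable_funU; [exact: measurable_set1|exact: measurable_seq|].
by split => //; exact: measurable_fun_set1.
Qed.

Lemma interior_segment (R : realFieldType) (a b y : R) : a < y < b ->
  [set z | a <= z <= b]° y.
Proof.
move=> /andP[ay yb].
apply: filterS (filterI (lt_nbhsr ay) (lt_nbhsl yb)) => z [az zb].
by apply/andP; split; exact: ltW.
Qed.

Section Speed.
Variables (R : realType) (n : nat) (M : manifold R n).
Implicit Types (g : metric_field M) (c : R -> M) (S : seq R).
Local Notation mu := (@lebesgue_measure R).

Lemma speed_ge0 g c y : 0 <= speed g c y.
Proof. exact: sqrtr_ge0. Qed.

Lemma speed_bounded g c S l r : riemannian_metric g -> smooth_curve c S l r ->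
  exists B, forall y, l <= y <= r -> speed g c y <= B.
Proof.
move=> rg [cc sc].
have piece a b y0 : l <= a -> a <= b -> b <= r -> a <= y0 <= b ->
    (forall z, z \in S -> ~~ (a < z < b)) ->
    exists B : R, \forall y \near y0, a < y < b -> speed g c y <= B.
  move=> la ab br y0ab nz.
  have cab : {within [set y | a <= y <= b], continuous c}.
    apply: continuous_subspaceW cc => y /=; rewrite in_itv /= => /andP[ay yb].
    by rewrite (le_trans la ay) (le_trans yb br).
  have [B HB] := speed_locally_bounded rg y0ab cab (sc a b la ab br nz).
  exists B; apply: filterS HB => y HB ayb; apply: HB.
  exact: interior_segment.
have local (y0 : R) : l <= y0 <= r ->
    exists B : R, \forall y \near y0, l <= y <= r -> speed g c y <= B.
  move=> /andP[ly0 y0r].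
  have [e e0 He] := finite_gap S y0.
  (* No break lies strictly between [y0 - e] and [y0], nor between [y0] and [y0 + e]: each side of
     [y0] belongs to one smooth piece, even if [y0] is itself a break. *)
  have [|||||B1 HB1] := piece (Num.max l (y0 - e)) y0 y0.
  - by rewrite le_max lexx.
  - by rewrite ge_max ly0 gerBl ltW.
  - by [].
  - by rewrite ge_max ly0 gerBl lexx ltW.
  - move=> z zS; apply/negP; rewrite gt_max -andbA => /and3P[_ ez zy].
    have := He z zS; rewrite lt_eqF // => /(_ isT).
    by rewrite ltr0_norm ?subr_lt0 // opprB leNgt ltrBlDr -ltrBlDl ez.
  have [|||||B2 HB2] := piece y0 (Num.min r (y0 + e)) y0.
  - by [].
  - by rewrite le_min y0r lerDl ltW.
  - by rewrite ge_min lexx.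
  - by rewrite le_min y0r lerDl lexx ltW.
  - move=> z zS; apply/negP; rewrite lt_min => /and3P[yz _ ze].
    have := He z zS; rewrite gt_eqF // => /(_ isT).
    by rewrite gtr0_norm ?subr_gt0 // leNgt ltrBlDl ze.
  (* Besides the bounds on the two sides of [y0], the values at [y0], [l] and [r] are included,
     since [piece] speaks of open intervals only. *)
  have ub (s1 s2 s3 s4 s5 : R) : exists B,
      [/\ s1 <= B, s2 <= B, s3 <= B, s4 <= B & s5 <= B].
    exists (Num.max (Num.max s1 s2) (Num.max s3 (Num.max s4 s5))).
    by split; rewrite !le_max lexx ?orbT.
  have [B [B1B B2B B3 B4 B5]] := ub B1 B2 (speed g c y0) (speed g c l) (speed g c r).
  exists B.
  have n1 : \forall y \near y0, y0 - e < y by apply: lt_nbhsr; rewrite gtrBl.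
  have n2 : \forall y \near y0, y < y0 + e by apply: lt_nbhsl; rewrite ltrDl.
  apply: filterS (filterI (filterI n1 n2) (filterI HB1 HB2)) => y [[y1 y2] [b1 b2]].
  move=> /andP[]; rewrite le_eqVlt => /predU1P[<- //|ly].
  rewrite le_eqVlt => /predU1P[-> //|yr].
  have [yy0|yy0|-> //] := ltgtP y y0.
    by apply: le_trans B1B; apply: b1; rewrite gt_max ly y1 yy0.
  by apply: le_trans B2B; apply: b2; rewrite lt_min yy0 yr y2.
(* Local bounds persist when [B] grows, so by compactness one large [B] serves all points. *)
have cov : near_covering `[l, r]%classic.
  by apply/compact_near_coveringP; exact: segment_compact.
pose P (B : R) y := l <= y <= r -> speed g c y <= B.
have Ploc y0 : `[l, r]%classic y0 -> \forall y \near y0 & B \near +oo, P B y.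
  rewrite /= in_itv /= => /local[B HB].
  exists ([set y | l <= y <= r -> speed g c y <= B], [set B' | B <= B']) => /=.
    by split => //; apply: nbhs_pinfty_ge; exact: num_real.
  by move=> [y B'] /= [yB BB'] /yB ylB; exact: le_trans BB'.
have Fy : Filter (pinfty_nbhs R) by apply: filter_filter.
have [B0 [_ HB]] := cov R (pinfty_nbhs R) P Fy Ploc.
exists (B0 + 1) => y ylr; apply: (HB (B0 + 1)) => //; by rewrite ltrDl.
Qed.

(** The speed is continuous on the open set [O], the segment without its ends and breaks; the rest
    is finite. *)
Lemma speed_measurable g c S l r : riemannian_metric g -> smooth_curve c S l r ->
  measurable_fun (`[l, r]%classic : set (measurableTypeR R)) (speed g c).
Proof.
move=> rg [cc sc].
pose S' := l :: r :: S.
pose O : set R := `]l, r[%classic `\` [set` S'].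
have openO : open O.
  rewrite /O setDE; apply: openI; first exact: itv_open.
  apply: closed_openC.
  apply: (accessible_finite_set_closed.1 _ _ (finite_seq S')).
  exact: hausdorff_accessible (@Rhausdorff R).
have openRm : measurable (O : set (measurableTypeR R)).
  rewrite /O; apply: measurableD; [exact: measurable_itv|exact: measurable_seq].
have sub : `[l, r]%classic `<=` O `|` [set` S'].
  move=> y; rewrite /= in_itv /= => /andP[ly yr].
  have [yS|yS] := boolP (y \in S'); [by right|left].
  move: yS; rewrite !inE !negb_or => /and3P[yl y_r yS]; split; rewrite /= ?in_itv /=.
    by rewrite lt_neqAle eq_sym yl ly lt_neqAle y_r yr.
  by apply/negP; rewrite !inE !negb_or yl y_r.
apply: (measurable_funS _ sub).
  by apply: measurableU; [exact: openRm|exact: measurable_seq].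
apply/measurable_funU; [exact: openRm|exact: measurable_seq|].
split; last exact: measurable_fun_seq.
apply: open_continuous_measurable_fun => // y0; rewrite inE => -[/= + /negP].
rewrite in_itv /= !inE !negb_or => /andP[ly0 y0r] /and3P[_ _ y0S].
have [e e0 He] := finite_gap S y0.
pose a := Num.max l (y0 - e); pose b := Num.min r (y0 + e).
have ay0 : a < y0 by rewrite gt_max ly0 gtrBl.
have y0b : y0 < b by rewrite lt_min y0r ltrDl.
have la : l <= a by rewrite le_max lexx.
have br : b <= r by rewrite ge_min lexx.
have cab : {within [set y | a <= y <= b], continuous c}.
  apply: continuous_subspaceW cc => y /=; rewrite in_itv /= => /andP[ay yb].
  by rewrite (le_trans la ay) (le_trans yb br).
have nz z : z \in S -> ~~ (a < z < b).
  move=> zS; apply/negP; rewrite gt_max lt_min => /andP[/andP[_ az] /andP[_ zb]].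
  have zy0 : z != y0 by apply: contraNneq y0S => <-.
  have := He z zS zy0; rewrite leNgt ltr_distl az zb //.
apply: (speed_continuous_at rg _ cab (sc a b la (ltW (lt_trans ay0 y0b)) br nz)).
by apply: interior_segment; rewrite ay0.
Qed.

Lemma speed_integrable g c S l r : riemannian_metric g -> smooth_curve c S l r ->
  mu.-integrable `[l, r] (EFin \o speed g c).
Proof.
move=> rg sc; apply: measurable_bounded_integrable.
- exact: measurable_itv.
- rewrite /= lebesgue_measure_itv /=; case: ifP => // _.
  by rewrite -EFinB ltry.
- exact: speed_measurable rg sc.
have [B HB] := speed_bounded rg sc.
exists B; split; first exact: num_real.
move=> B' BB' y /=; rewrite in_itv /= => ylr.
by rewrite ger0_norm ?speed_ge0 //; apply: le_trans (HB y ylr) (ltW BB').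
Qed.

End Speed.

(** * Length and distance *)

Section AffineIntegral.
Variable R : realType.
Local Notation mu := (@lebesgue_measure R).
Local Notation mR := (measurableTypeR R).
Variables (al be : R).
Hypothesis al0 : al != 0.

Let aff (y : R) : R := al * y + be.

Let measurable_aff : measurable_fun setT (aff : mR -> mR).
Proof. by apply: continuous_measurable_fun; exact: affine_continuous. Qed.

Lemma affine_preimage_ocitv (a b : R) :
  (`|al|%:E * mu (aff @^-1` `]a, b]%classic))%E = mu `]a, b]%classic.
Proof.
move: al0; rewrite neq_lt => /orP[al_lt0|al_gt0].
  have -> : aff @^-1` `]a, b]%classic = `[(b - be) / al, (a - be) / al[%classic.
    apply/seteqP; split=> y; rewrite /= !in_itv /= => /andP[].
      move=> ay yb; rewrite ler_ndivrMr // ltr_ndivlMr // ltrBlDr lerBrDr.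
      by rewrite mulrC yb ay.
    rewrite ler_ndivrMr // ltr_ndivlMr // ltrBlDr lerBrDr.
    by rewrite /aff mulrC => -> ->.
  rewrite !lebesgue_measure_itv /= !lte_fin ltr_nM2r ?invr_lt0 // ltrD2r.
  case: ifP => // ab; rewrite ?mule0 // -!EFinB -EFinM ltr0_norm //; congr _%:E.
  by field; rewrite lt_eqF.
have -> : aff @^-1` `]a, b]%classic = `](a - be) / al, (b - be) / al]%classic.
  apply/seteqP; split=> y; rewrite /= !in_itv /= => /andP[].
    move=> ay yb; rewrite ler_pdivlMr // ltr_pdivrMr // ltrBlDr lerBrDr.
    by rewrite mulrC yb ay.
  rewrite ler_pdivlMr // ltr_pdivrMr // ltrBlDr lerBrDr.
  by rewrite /aff mulrC => -> ->.
rewrite !lebesgue_measure_itv /= !lte_fin ltr_pM2r ?invr_gt0 // ltrD2r.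
case: ifP => // ab; rewrite ?mule0 // -!EFinB -EFinM gtr0_norm //; congr _%:E.
by field; rewrite gt_eqF.
Qed.

(** The image of Lebesgue measure under [aff], scaled by [|al|], is Lebesgue measure again, because
    the two agree on half-open intervals. *)
Lemma ge0_integral_affine (D : set mR) (f : R -> \bar R) :
  measurable D -> measurable_fun D f -> (forall y, D y -> 0 <= f y)%E ->
  (\int[mu]_(y in aff @^-1` D) (`|al|%:E * f (aff y)) = \int[mu]_(y in D) f y)%E.
Proof.
move=> mD mf f0.
pose affB := isMeasurableFun.Build _ _ _ _ (aff : mR -> mR) measurable_aff.
pose affm : {mfun mR >-> mR} := HB.pack (aff : mR -> mR) affB.
have mD' : measurable (aff @^-1` D : set mR).
  by rewrite -[X in measurable X]setTI; exact: measurable_aff.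
rewrite ge0_integralZl_EFin //=; last first.
- apply: (measurable_comp mD _ mf); first by move=> _ [y Dy <-].
  exact: measurable_funTS.
- by move=> y Dy; exact: f0.
rewrite -(ge0_integral_pushforward measurable_aff mu mD mf); last first.
  by move=> y; rewrite inE => /f0.
rewrite -(ge0_integral_mscale (pushforward mu affm) mD (NngNum (normr_ge0 al)) mf f0).
apply: eq_measure_integral => A mA _; apply/esym.
apply: lebesgue_measure_unique => // _ [[a b]] _ <-.
exact/esym/affine_preimage_ocitv.
Qed.

End AffineIntegral.

Lemma ge0_integral_eq_off_seq (R : realType) (s : seq R) (D : set (measurableTypeR R))
    (f h : R -> R) :
  measurable D -> measurable_fun D f -> measurable_fun D h ->
  (forall y, 0 <= f y) -> (forall y, 0 <= h y) ->
  (forall y, D y -> y \notin s -> f y = h y) ->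
  (\int[@lebesgue_measure R]_(y in D) (f y)%:E =
   \int[@lebesgue_measure R]_(y in D) (h y)%:E)%E.
Proof.
move=> mD mf mh f0 h0 fh; apply: ge0_ae_eq_integral => //.
- exact/measurable_EFinP.
- exact/measurable_EFinP.
- by move=> y _; rewrite lee_fin.
- by move=> y _; rewrite lee_fin.
exists [set` s]; split.
- exact: measurable_seq.
- apply: countable_lebesgue_measure0.
  exact: finite_set_countable (finite_seq s).
move=> y /= /not_implyP[Dy]; apply: contra_notP => /negP ys.
by rewrite fh.
Qed.

Section Distance.
Variables (R : realType) (n : nat) (M : manifold R n).
Implicit Types (g : metric_field M) (c : R -> M) (S : seq R).
Local Notation mu := (@lebesgue_measure R).

Lemma speed_near_eq g c c' (y : R) : (\forall z \near y, c z = c' z) ->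
  speed g c y = speed g c' y.
Proof.
move=> cc'; rewrite /speed (nbhs_singleton cc') !derive1E.
set i := chart_at (c' y).
have E : \forall z \near y, (chart_coord i \o c) z = (chart_coord i \o c') z.
  by apply: filterS cc' => z /= ->.
by rewrite (near_eq_derive _ E).
Qed.

(** Pulling [al] out of ['D_(al * 1)] takes a differentiable curve, whence a point away from the
    breaks and the end points. *)
Lemma speed_affine g c S l r (al be y : R) :
  smooth_curve c S l r -> l < al * y + be < r -> al * y + be \notin S ->
  speed g (fun z => c (al * z + be)) y = `|al| * speed g c (al * y + be).
Proof.
move=> [cc sc]; set y0 := al * y + be => /andP[ly0 y0r] y0S.
have [e e0 He] := finite_gap S y0.
pose a := Num.max l (y0 - e); pose b := Num.min r (y0 + e).
have ay0 : a < y0 by rewrite gt_max ly0 gtrBl.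
have y0b : y0 < b by rewrite lt_min y0r ltrDl.
have la : l <= a by rewrite le_max lexx.
have br : b <= r by rewrite ge_min lexx.
have cab : {within [set y | a <= y <= b], continuous c}.
  apply: continuous_subspaceW cc => z /=; rewrite in_itv /= => /andP[az zb].
  by rewrite (le_trans la az) (le_trans zb br).
have nz z : z \in S -> ~~ (a < z < b).
  move=> zS; apply/negP; rewrite gt_max lt_min => /andP[/andP[_ az] /andP[_ zb]].
  have zy0 : z != y0 by apply: contraNneq y0S => <-.
  by have := He z zS zy0; rewrite leNgt ltr_distl az zb.
have sab := sc a b la (ltW (lt_trans ay0 y0b)) br nz.
have iab : [set y | a <= y <= b]° y0 by apply: interior_segment; rewrite ay0.
rewrite /speed -/y0; set i := chart_at (c y0).
have /derivable1_diffP dc := smooth_piece_derivable cab sab iab (chart_at_dom (c y0)).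
have -> : derive1 (chart_coord i \o (fun z => c (al * z + be))) y =
    al *: derive1 (chart_coord i \o c) y0.
  rewrite !derive1E.
  have -> : 'D_1 (chart_coord i \o (fun z => c (al * z + be))) y =
      'D_(al * 1) (chart_coord i \o c) y0.
    exact: (congr1 (fun f => f y) (derive_affine al be (chart_coord i \o c) 1)).
  by rewrite !deriveE // -linearZ.
rewrite linearZ /= -!scalemxAl -scalemxAr !mxE mulrA -expr2.
by rewrite sqrtrM ?sqr_ge0 // sqrtr_sqr.
Qed.

Lemma integral_speed_affine g c S l r (al be l' r' : R) :
  riemannian_metric g -> al != 0 ->
  (forall y, (l' <= y <= r') = (l <= al * y + be <= r)) ->
  smooth_curve c S l r ->
  (\int[mu]_(y in `[l', r']) (speed g (fun z => c (al * z + be)) y)%:E =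
   \int[mu]_(y in `[l, r]) (speed g c y)%:E)%E.
Proof.
move=> rg al0 lr sc.
set c' := fun y => c (al * y + be).
have sc' : smooth_curve c' [seq (z - be) / al | z <- S] l' r'.
  by apply: smooth_curve_affine sc => // y; rewrite lr.
have mlr : measurable (`[l, r]%classic : set (measurableTypeR R)).
  exact: measurable_itv.
have msp := speed_measurable rg sc.
have emsp : measurable_fun (`[l, r]%classic : set (measurableTypeR R))
    (EFin \o speed g c) by exact/measurable_EFinP.
rewrite -(ge0_integral_affine be al0 mlr emsp); last first.
  by move=> y _; rewrite lee_fin speed_ge0.
have -> : (fun y => al * y + be) @^-1` `[l, r]%classic = `[l', r']%classic.
  by apply/seteqP; split=> y; rewrite /= !in_itv /= lr.
under [RHS]eq_integral do rewrite -EFinM.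
have inv y : (al * y + be - be) / al = y by rewrite addrK mulrAC mulfV // mul1r.
have mlr' : measurable (`[l', r']%classic : set (measurableTypeR R)).
  exact: measurable_itv.
pose h y := `|al| * speed g c (al * y + be).
have mh : measurable_fun (`[l', r']%classic : set (measurableTypeR R)) h.
  apply: measurable_funM; first exact: measurable_cst.
  apply: (measurable_comp mlr _ msp).
    by move=> _ [y /= ylr' <-]; rewrite in_itv /= -lr; rewrite in_itv in ylr'.
  by apply: measurable_funTS; apply: continuous_measurable_fun; exact: affine_continuous.
have h0 y : 0 <= h y by exact: mulr_ge0 (normr_ge0 _) (speed_ge0 _ _ _).
have E y : `[l', r']%classic y -> y \notin [seq (z - be) / al | z <- l :: r :: S] ->
    speed g c' y = h y.
  move=> ylr' yS; move: ylr'; rewrite /= in_itv /= lr => /andP[ly yr].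
  have {}yS : al * y + be \notin l :: r :: S.
    by apply: contra yS => yS; apply/mapP; exists (al * y + be); rewrite ?inv.
  move: yS; rewrite !inE !negb_or => /and3P[yl y_r yS].
  apply: (speed_affine g sc _ yS).
  by rewrite !lt_neqAle ly yr y_r [l == _]eq_sym yl.
exact: (ge0_integral_eq_off_seq mlr' (speed_measurable rg sc') mh
          (speed_ge0 g c') h0 E).
Qed.

End Distance.

(** * Symmetry and triangle inequality for the distance *)

Section Distance.
Variables (R : realType) (n : nat) (M : manifold R n).
Implicit Types (g : metric_field M) (c : R -> M) (S : seq R).
Local Notation mu := (@lebesgue_measure R).
Local Notation mR := (measurableTypeR R).

Let measurable_speed g c S l r : riemannian_metric g -> smooth_curve c S l r ->
  measurable_fun (`[l, r]%classic : set mR) (EFin \o speed g c).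
Proof. by move=> rg sc; apply/measurable_EFinP; exact: speed_measurable rg sc. Qed.

Lemma rdist_ge0 g (x y : M) : (0 <= rdist g x y)%E.
Proof.
apply: le_ereal_inf_tmp => _ [c _ <-]; apply: integral_ge0 => z _.
by rewrite lee_fin speed_ge0.
Qed.

(** Slope [r - l] gives [rdist_le]; slope [-1] reverses the curve and gives [rdist_sym_lt]. *)
Lemma rdist_le_affine g c S l r (al be : R) : riemannian_metric g -> al != 0 ->
  (forall y, (0 <= y <= 1) = (l <= al * y + be <= r)) ->
  smooth_curve c S l r ->
  (rdist g (c be) (c (al + be)%R) <= \int[mu]_(y in `[l, r]) (speed g c y)%:E)%E.
Proof.
move=> rg al0 lr sc; rewrite -(integral_speed_affine rg al0 lr sc).
apply: ereal_inf_lbound; exists (fun y => c (al * y + be)) => //; split.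
- apply: (@smooth_curve_piecewise _ _ _ _ [seq (z - be) / al | z <- S]).
  by apply: smooth_curve_affine sc => // y; rewrite lr.
- by rewrite mulr0 add0r.
- by rewrite mulr1.
Qed.

Lemma rdist_le g c S l r : riemannian_metric g -> l < r -> smooth_curve c S l r ->
  (rdist g (c l) (c r) <= \int[mu]_(y in `[l, r]) (speed g c y)%:E)%E.
Proof.
move=> rg lr sc; have rl : 0 < r - l by rewrite subr_gt0.
have := @rdist_le_affine g c S l r (r - l) l rg (lt0r_neq0 rl) _ sc.
rewrite subrK; apply => y.
rewrite -lerBlDr subrr -lerBrDr.
by rewrite pmulr_rge0 // -{2}[r - l]mulr1 ler_pM2l.
Qed.

Lemma rdist_curve g (x y : M) (e : R) : (rdist g x y < e%:E)%E ->
  exists c S, [/\ smooth_curve c S 0 1, c 0 = x, c 1 = y &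
    (\int[mu]_(y in `[0%R, 1%R]) (speed g c y)%:E < e%:E)%E].
Proof.
move=> /ereal_inf_lt[_ [c [/piecewise_smooth_curve[S sc] c0 c1] <-] ce].
by exists c, S.
Qed.

Lemma rdist_sym_lt g (x y : M) (e : R) : riemannian_metric g ->
  (rdist g x y < e%:E)%E -> (rdist g y x < e%:E)%E.
Proof.
move=> rg /rdist_curve[c [S [sc <- <- ce]]]; apply: le_lt_trans ce.
have N1 : (-1 : R) != 0 by rewrite oppr_eq0 oner_eq0.
have := @rdist_le_affine g c S 0 1 (-1) 1 rg N1 _ sc.
rewrite addNr; apply => z; apply/idP/idP => /andP[? ?]; apply/andP; split; lra.
Qed.

(** The second curve is moved to [[1, 2]] and glued to the first. The speed of the result agrees
    with those of its halves except possibly at the junction 1. *)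
Lemma rdist_concat g c1 c2 S1 S2 : riemannian_metric g ->
  smooth_curve c1 S1 0 1 -> smooth_curve c2 S2 0 1 -> c1 1 = c2 0 ->
  (rdist g (c1 0%R) (c2 1%R) <= \int[mu]_(y in `[0%R, 1%R]) (speed g c1 y)%:E +
    \int[mu]_(y in `[0%R, 1%R]) (speed g c2 y)%:E)%E.
Proof.
move=> rg sc1 sc2 c12.
have one0 : (1 : R) != 0 by exact: oner_neq0.
pose c2' (y : R) := c2 (1 * y + -1).
have shift (y : R) : (1 <= y <= 2) = (0 <= 1 * y + -1 <= 1).
  by apply/idP/idP => /andP[? ?]; apply/andP; split; lra.
have sc2' : smooth_curve c2' [seq (z - -1) / 1 | z <- S2] 1 2.
  by apply: smooth_curve_affine sc2 => // y; rewrite shift.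
pose c (y : R) := if y <= 1 then c1 y else c2' y.
have c12' : c1 1 = c2' 1 by rewrite /c2' mulr1 subrr.
have le12 : (1 : R) <= 2 by rewrite ler1n.
have sc := smooth_curve_concat ler01 le12 c12' sc1 sc2'.
have -> : c1 0 = c 0 by rewrite /c ler01.
have -> : c2 1 = c 2.
  rewrite /c leNgt ltr1n /= /c2'; congr c2; lra.
apply: le_trans (rdist_le rg _ sc) _; first by rewrite ltr0n.
have m01 : measurable (`[0, 1]%classic : set mR) by exact: measurable_itv.
have m12 : measurable (`]1, 2]%classic : set mR) by exact: measurable_itv.
have m12' : measurable (`[1, 2]%classic : set mR) by exact: measurable_itv.
have E02 : `[0, 2]%classic = `[0, 1]%classic `|` `]1, 2]%classic :> set R.
  apply/seteqP; split=> y; rewrite /= !in_itv /=.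
    by move=> /andP[y0 y2]; have [y1|y1] := leP y 1; [left|right]; rewrite ?y0 ?y1.
  by case=> /andP[? ?]; apply/andP; split; lra.
have msp := measurable_speed rg sc.
rewrite E02 in msp *.
have pos (D : set R) y : D y -> (0 <= (EFin \o speed g c) y)%E.
  by move=> _; rewrite lee_fin speed_ge0.
have disj : disj_set (`[0, 1]%classic : set mR) `]1, 2]%classic.
  apply/disj_setPS => y /= []; rewrite !in_itv /= => /andP[_ y1] /andP[].
  by rewrite ltNge y1.
rewrite (ge0_integral_setU mu m01 m12 msp (pos _) disj).
have sp1 : (\int[mu]_(y in `[0%R, 1%R]) (speed g c y)%:E =
    \int[mu]_(y in `[0%R, 1%R]) (speed g c1 y)%:E)%E.
  apply: (@ge0_integral_eq_off_seq _ [:: 1] _ _ _ m01).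
  - exact: speed_measurable rg (smooth_curveW (lexx 0) le12 sc).
  - exact: speed_measurable rg sc1.
  - exact: speed_ge0.
  - exact: speed_ge0.
  move=> y; rewrite /= in_itv /= inE => /andP[_ y1] yn1.
  apply: speed_near_eq; have lty1 : y < 1 by rewrite lt_neqAle yn1.
  by apply: filterS (lt_nbhsl lty1) => z /ltW z1; rewrite /c z1.
have sp2 : (\int[mu]_(y in `[1%R, 2%R]) (speed g c y)%:E =
    \int[mu]_(y in `[1%R, 2%R]) (speed g c2' y)%:E)%E.
  apply: (@ge0_integral_eq_off_seq _ [:: 1] _ _ _ m12').
  - exact: speed_measurable rg (smooth_curveW ler01 (lexx 2) sc).
  - exact: speed_measurable rg sc2'.
  - exact: speed_ge0.
  - exact: speed_ge0.
  move=> y; rewrite /= in_itv /= inE => /andP[y1 _] yn1.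
  apply: speed_near_eq; have lty1 : 1 < y by rewrite lt_neqAle eq_sym yn1.
  by apply: filterS (lt_nbhsr lty1) => z z1; rewrite /c leNgt z1.
have sp3 := integral_speed_affine rg one0 shift sc2.
have eq_le (a b : \bar R) : a = b -> (a <= b)%E by move=> ->.
apply: leeD; first exact: (eq_le _ _ sp1).
apply: (le_trans _ (eq_le _ _ (etrans sp2 sp3))).
apply: (ge0_subset_integral mu m12 m12' _ (pos _)).
  exact: measurable_speed rg (smooth_curveW ler01 (lexx 2) sc).
by move=> y; rewrite /= !in_itv /= => /andP[/ltW-> ->].
Qed.

(** A curve from [x] to [y] of length [l1 < a] leaves the slack [a - l1], which suffices to choose a
    curve from [y] to [z] even if their distance equals [b]. *)
Lemma rdist_triangle_lt g (x y z : M) (a b : R) : riemannian_metric g ->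
  (rdist g x y < a%:E)%E -> (rdist g y z <= b%:E)%E ->
  (rdist g x z < (a + b)%:E)%E.
Proof.
move=> rg /rdist_curve[c1 [S1 [sc1 c10 c11 ca]]] yz.
set l1 := (\int[mu]_(y in _) _)%E in ca.
have l1_0 : (0 <= l1)%E.
  by apply: integral_ge0 => w _; rewrite lee_fin speed_ge0.
have l1f : l1 \is a fin_num by rewrite ge0_fin_numE // (lt_trans ca) ?ltry.
have : (rdist g y z < (b + (a - fine l1))%:E)%E.
  apply: le_lt_trans yz _; rewrite lte_fin ltrDl subr_gt0.
  by rewrite -lte_fin fineK.
move=> /rdist_curve[c2 [S2 [sc2 c20 c21 cb]]].
have key (u v : \bar R) : u \is a fin_num ->
    (v < (b + (a - fine u))%:E)%E -> (u + v < (a + b)%:E)%E.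
  move=> uf vlt; rewrite -(fineK uf).
  apply: lt_le_trans (lee_ltD _ (lexx _) vlt) _ => //.
  by rewrite -EFinD lee_fin addrCA [_ + (_ - _)]addrC subrK addrC.
have c12 : c1 1 = c2 0 by rewrite c11 c20.
rewrite -c10 -c21; exact: le_lt_trans (rdist_concat rg sc1 sc2 c12) (key _ _ l1f cb).
Qed.

End Distance.

(** * Parabolic cylinders and the Riemann scale *)

Section Containment.
Variables (R : realType) (n : nat) (M : manifold R n).
Implicit Types (c : R -> M) (S : seq R).
Local Notation mu := (@lebesgue_measure R).
Local Notation mR := (measurableTypeR R).

(* A first-exit argument: as long as the curve stays in the ball its
   [g1]-length is controlled by its [g2]-length, so that it cannot leave. The
   exit time is replaced by a time at which [d + int_0^y speed g1 c] takes a
   given value below [rho]. *)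
Lemma ball_along_curve (g1 g2 : metric_field M) (p : M) c S (lam rho d L : R) :
  riemannian_metric g1 -> riemannian_metric g2 -> smooth_curve c S 0 1 ->
  0 < lam -> (rdist g1 p (c 0%R) < d%:E)%E ->
  (forall y, (rdist g1 p (c y) < rho%:E)%E -> speed g1 c y <= lam * speed g2 c y) ->
  (\int[mu]_(y in `[0%R, 1%R]) (speed g2 c y)%:E < L%:E)%E ->
  d + lam * L <= rho -> (rdist g1 p (c 1%R) < rho%:E)%E.
Proof.
move=> rg1 rg2 sc lam0 pc0 sp12 LL dL.
pose I1 y := parameterized_integral mu 0 y (speed g1 c).
have scy (y : R) : 0 <= y <= 1 -> smooth_curve c S 0 y.
  by move=> /andP[y0 y1]; exact: smooth_curveW sc.
have int g y : riemannian_metric g -> 0 <= y <= 1 ->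
    mu.-integrable `[0, y] (EFin \o speed g c).
  by move=> rg y01; exact: (speed_integrable rg (scy y y01)).
have mI (y : R) : measurable (`[0, y]%classic : set mR) by exact: measurable_itv.
have IE y : 0 <= y <= 1 ->
    (I1 y)%:E = (\int[mu]_(z in `[0%R, y]) (speed g1 c z)%:E)%E.
  move=> y01; rewrite /I1 /parameterized_integral /Rintegral fineK //.
  exact: (integrable_fin_num (mI _) (int g1 y rg1 y01)).
have I1c : {within `[0, 1], continuous I1}.
  apply: parameterized_integral_continuous ler01 _.
  by apply: int rg1 _; rewrite ler01 lexx.
have Imono (g : metric_field M) y z : riemannian_metric g -> y <= z -> 0 <= z <= 1 ->
    (\int[mu]_(w in `[0%R, y]) (speed g c w)%:E <=
     \int[mu]_(w in `[0%R, z]) (speed g c w)%:E)%E.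
  move=> rg yz z01; apply: ge0_subset_integral.
  - exact: measurable_itv.
  - exact: measurable_itv.
  - by apply/measurable_EFinP; exact: (speed_measurable rg (scy z z01)).
  - by move=> w _; rewrite lee_fin speed_ge0.
  - by move=> w; rewrite /= !in_itv /= => /andP[-> wy]; exact: le_trans yz.
have I1_0 : I1 0 = 0.
  by rewrite /I1 /parameterized_integral set_itv1 Rintegral_set1.
have dist_lt y : 0 <= y <= 1 -> (rdist g1 p (c y) < (d + I1 y)%:E)%E.
  move=> y01; have /andP[y0 y1] := y01.
  move: y0; rewrite le_eqVlt => /predU1P[<-|y0]; first by rewrite I1_0 addr0.
  apply: (rdist_triangle_lt rg1 pc0).
  by rewrite (IE y y01); exact: (rdist_le rg1 y0 (scy y y01)).
have one01 : 0 <= (1 : R) <= 1 by rewrite ler01 lexx.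
have [h1|h1] := ltP (d + I1 1) rho.
  by apply: (lt_trans (dist_lt _ one01)); rewrite lte_fin.
exfalso.
set L2 := (\int[mu]_(y in _) _)%E in LL.
have L2f : L2 \is a fin_num.
  exact: (integrable_fin_num (mI _) (int g2 1 rg2 one01)).
have L2L : fine L2 < L by rewrite -lte_fin fineK.
have v0 : d + lam * fine L2 < rho.
  by apply: lt_le_trans dL; rewrite ltrD2l ltr_pM2l.
(* At a time [y] with [d + I1 y = v < rho] the curve has stayed in the ball, so
   [I1 y <= lam * fine L2]; this contradicts [v > d + lam * fine L2]. *)
pose v := (d + lam * fine L2 + rho) / 2.
have v1 : d + lam * fine L2 < v by rewrite /v; lra.
have v2 : v < rho by rewrite /v; lra.
have L20 : 0 <= fine L2.
  by apply: fine_ge0; apply: integral_ge0 => y _; rewrite lee_fin speed_ge0.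
have vI : Num.min (I1 0) (I1 1) <= v - d <= Num.max (I1 0) (I1 1).
  rewrite ge_min le_max I1_0; apply/andP; split; apply/orP; [left|right].
    have := mulr_ge0 (ltW lam0) L20; lra.
  lra.
have [y + Iy] := IVT ler01 I1c vI.
rewrite in_itv /= => y01; have /andP[y0 y1] := y01.
have inball z : 0 <= z <= y -> speed g1 c z <= lam * speed g2 c z.
  move=> /andP[z0 zy]; apply: sp12.
  have z01 : 0 <= z <= 1 by rewrite z0 (le_trans zy).
  apply: (lt_trans (dist_lt _ z01)); rewrite lte_fin.
  apply: le_lt_trans v2; rewrite -lerBrDl -Iy -lee_fin (IE z z01) (IE y y01).
  exact: Imono.
have : ((I1 y)%:E <= (lam * fine L2)%:E)%E.
  rewrite (IE y y01) EFinM fineK //.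
  apply: (@le_trans _ _
    (lam%:E * \int[mu]_(z in `[0%R, y]) (speed g2 c z)%:E)%E); last first.
    by apply: lee_wpmul2l; [rewrite lee_fin ltW|exact: Imono].
  have mg2 : measurable_fun (`[0, y]%classic : set mR) (EFin \o speed g2 c).
    by apply/measurable_EFinP; exact: (speed_measurable rg2 (scy y y01)).
  rewrite -(@ge0_integralZl_EFin _ _ _ mu _ (mI y) (EFin \o speed g2 c) _ mg2
    lam (ltW lam0)); last first.
    by move=> z _; rewrite lee_fin speed_ge0.
  apply: ge0_le_integral.
  - exact: measurable_itv.
  - by move=> z _; rewrite lee_fin speed_ge0.
  - by apply/measurable_EFinP; exact: (speed_measurable rg1 (scy y y01)).
  - exact: measurable_funeM.
  - move=> z; rewrite /= in_itv /= => zy; rewrite -EFinM lee_fin.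
    exact: inball.
rewrite lee_fin Iy => vl; move: v1; rewrite ltNge; apply/negP/negPn.
by rewrite -lerBlDl.
Qed.

End Containment.

Section Flow.
Variables (R : realType) (n : nat) (M : manifold R n) (T : \bar R).
Variable g : R -> metric_field M.
Hypothesis flow : ricci_flow T g.

Lemma flow_riemannian (t : R) : 0 < t -> (t%:E < T)%E -> riemannian_metric (g t).
Proof. by move=> t0 tT; apply: (flow_metric flow); split => //; exact: ltW. Qed.

Lemma parabolic_cylinderE (p q : M) (t s r : R) :
  parabolic_cylinder T g p t r%:E (q, s) <->
  [/\ (rdist (g t) p q < r%:E)%E, `|s - t| < r ^+ 2, 0 < s & (s%:E < T)%E].
Proof.
have e2 : (r%:E ^+ 2 = (r ^+ 2)%:E :> \bar R)%E by rewrite EFin_expe.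
rewrite /parabolic_cylinder e2 -EFinB -EFinD /= gt_max lt_min !lte_fin.
rewrite ltr_distl; split.
  by move=> [-> /andP[/andP[-> ->] /andP[-> ->]]].
by move=> [-> /andP[-> ->] -> ->].
Qed.

Lemma speed_comparison (c : R -> M) (y t s K : R) :
  0 < t -> (t%:E < T)%E -> 0 < s -> (s%:E < T)%E ->
  (forall w, `|w - t| <= `|s - t| -> 0 < w -> (w%:E < T)%E ->
    norm_Rm (g w) (c y) <= K) ->
  2 * n%:R ^+ 2 * K * `|s - t| <= 2^-1 ->
  speed (g t) c y <= 3 / 2 * speed (g s) c y.
Proof.
move=> t0 tT s0 sT HK KE.
pose i := chart_at (c y); pose u := chart_coord i (c y).
pose v : 'rV[R]_n := derive1 (chart_coord i \o c) y.
pose q w := (v *m g w i u *m v^T) 0 0.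
have q0 : 0 <= q s.
  have [v0|v0] := eqVneq v 0; first by rewrite /q v0 !mul0mx mxE.
  apply/ltW; apply: (riem_posdef (flow_riemannian s0 sT)) => //.
  by exists (c y) => //; exact: chart_at_dom.
have qle : q t <= expR (2 * n%:R ^+ 2 * K * `|s - t|) * q s.
  have [st|ts] := leP s t.
    have HK' w : s <= w <= t -> norm_Rm (g w) (c y) <= K.
      move=> /andP[sw wt]; apply: HK.
      - by rewrite !ler0_norm ?subr_le0 // lerN2 lerD2r.
      - exact: lt_le_trans sw.
      - by apply: le_lt_trans tT; rewrite lee_fin.
    have [H _] := metric_comparison v flow s0 st tT HK'.
    by rewrite ler0_norm ?subr_le0 // opprB.
  have HK' w : t <= w <= s -> norm_Rm (g w) (c y) <= K.
    move=> /andP[tw ws]; apply: HK.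
    - by rewrite !ger0_norm ?subr_ge0 ?lerD2r // ltW.
    - exact: lt_le_trans tw.
    - by apply: le_lt_trans sT; rewrite lee_fin.
  have [_ H] := metric_comparison v flow t0 (ltW ts) sT HK'.
  by rewrite gtr0_norm ?subr_gt0.
(* From [exp(-1/2) >= 1/2] one gets [exp(1/2) <= 2 <= 9/4]; the square root then gives 3/2 for
   speeds. *)
have e94 : expR (2 * n%:R ^+ 2 * K * `|s - t|) <= (3 / 2) ^+ 2.
  apply: (@le_trans _ _ (expR 2^-1)); first by rewrite ler_expR.
  have e1 := expR_ge1Dx (- 2^-1 : R).
  have e2 : expR (2^-1) * expR (- 2^-1) = 1 :> R by rewrite -expRD subrr expR0.
  have e3 := expR_gt0 (2^-1 : R).
  nra.
have -> : speed (g t) c y = Num.sqrt (q t) by [].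
have -> : speed (g s) c y = Num.sqrt (q s) by [].
have p32 : 0 <= 3 / 2 :> R by lra.
rewrite -[X in X * _](ger0_norm p32) -sqrtr_sqr -sqrtrM ?sqr_ge0 //.
apply: ler_wsqrtr; apply: le_trans qle _.
exact: ler_wpM2r.
Qed.

Definition curvature_radius (p : M) (t r : R) : Prop := 0 < r /\
  forall q s, parabolic_cylinder T g p t r%:E (q, s) -> norm_Rm (g s) q < r ^- 2.

(** With [K = rho^-2] the condition [4 n^2 |s - t| <= rho^2] is the smallness condition of
    [speed_comparison], and [|s - t| < rho^2] keeps the intermediate times in the cylinder. *)
Lemma ball_containment (p x z : M) (t s rho d L : R) :
  0 < t -> (t%:E < T)%E -> 0 < s -> (s%:E < T)%E ->
  curvature_radius p t rho ->
  `|s - t| < rho ^+ 2 -> 4 * n%:R ^+ 2 * `|s - t| <= rho ^+ 2 ->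
  (rdist (g t) p x < d%:E)%E -> (rdist (g s) x z < L%:E)%E ->
  d + 3 / 2 * L <= rho -> (rdist (g t) p z < rho%:E)%E.
Proof.
move=> t0 tT s0 sT [rho0 Hrho] st nst px /rdist_curve[c [S [sc c0 <- cL]]] dL.
have rt := flow_riemannian t0 tT; have rs := flow_riemannian s0 sT.
have p32 : 0 < 3 / 2 :> R by lra.
rewrite -c0 in px.
apply: (ball_along_curve rt rs sc p32 px _ cL dL) => y py.
apply: (@speed_comparison c y t s (rho ^- 2)) => //.
  move=> w ws w0 wT; apply/ltW/Hrho/parabolic_cylinderE; split => //.
  exact: le_lt_trans ws st.
have rho20 : 0 < rho ^+ 2 by rewrite exprn_gt0.
rewrite mulrAC ler_pdivrMr //; lra.
Qed.

Lemma rdist_refl_lt (t : R) (x : M) (e : R) : 0 < e -> (rdist (g t) x x < e%:E)%E.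
Proof.
move=> e0; have speed0 y : speed (g t) (fun=> x) y = 0.
  rewrite /speed derive1E (_ : _ \o _ = cst (chart_coord (chart_at x) x)) //.
  by rewrite derive_cst !mul0mx mxE sqrtr0.
apply: (@le_lt_trans _ _ (curve_length (g t) (fun=> x))); last first.
  rewrite /curve_length; under eq_integral do rewrite speed0.
  by rewrite integral0 lte_fin.
apply: ereal_inf_lbound; exists (fun=> x) => //; split => //.
apply: (@smooth_curve_piecewise _ _ _ _ [::]); split.
  by apply: continuous_subspaceT => y; exact: cvg_cst.
move=> a b _ _ _ _ i y _; exists setT, (cst (chart_coord i x)).
split => //; first exact: openT.
move=> k; move: (chart_coord i x); elim: k => [|k IH] u; split => //.
- by move=> z _; exact: cvg_cst.
- by move=> z _; exact: cvg_cst.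
move=> v; split; first by move=> z _; exact: derivable_cst.
rewrite (_ : 'D_v _ = cst 0); first exact: IH.
by apply/funext => z; rewrite derive_cst.
Qed.

End Flow.

Lemma inv_sqr_lt (R : realFieldType) (a b : R) : 0 < a -> a < b -> b ^- 2 < a ^- 2.
Proof.
move=> a0 ab; have b0 := lt_trans a0 ab.
by rewrite ltf_pV2 ?posrE ?exprn_gt0 //; nra.
Qed.

(** * Comparison of the scales at nearby points *)

Section Scale.
Variables (R : realType) (n : nat) (M : manifold R n) (T : \bar R).
Variable g : R -> metric_field M.
Hypothesis flow : ricci_flow T g.
Local Notation mu := (@lebesgue_measure R).

Definition scale_sup (p : M) (t : R) : \bar R :=
  ereal_sup [set r%:E | r in curvature_radius T g p t].

(** Each point of any cylinder around [(q, s)] is at finite [g(t)]-distance from [p], hence lies in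
    a cylinder around [(p, t)] with arbitrarily large curvature radius [rho]. This [rho] may depend
    on the point. *)
Lemma scale_sup_infinite (p q : M) (t s : R) :
  0 < t -> (t%:E < T)%E -> 0 < s -> (s%:E < T)%E ->
  (rdist (g t) p q < +oo)%E -> scale_sup p t = +oo%E -> scale_sup q s = +oo%E.
Proof.
move=> t0 tT s0 sT pq supy.
have rt := flow_riemannian flow t0 tT; have rs := flow_riemannian flow s0 sT.
have good r0 : 0 < r0 -> curvature_radius T g q s r0.
  move=> r00; split => // q' s' /parabolic_cylinderE[].
  move=> /rdist_curve[c [S [sc c0 <- _]]] s's s'0 s'T.
  have pqf : rdist (g t) p q \is a fin_num by rewrite ge0_fin_numE // rdist_ge0.
  have m01 : measurable (`[0, 1]%classic : set (measurableTypeR R)).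
    exact: measurable_itv.
  have qq'f := integrable_fin_num m01 (speed_integrable rt sc).
  set I := (\int[_]_(y in _) _)%E in qq'f.
  have qq' : (rdist (g t) q (c 1%R) <= (fine I)%:E)%E.
    by rewrite fineK // -c0; exact: (rdist_le rt ltr01 sc).
  pose D := fine (rdist (g t) p q) + 1 + fine I.
  have pq' : (rdist (g t) p (c 1%R) < D%:E)%E.
    apply: (rdist_triangle_lt rt _ qq').
    by rewrite EFinD fineK // lteDl.
  (* The three terms ensure that [rho] exceeds the distance, that [rho^-2 < r0^-2], and that
     [rho^2 > |s' - t|]. *)
  pose b := Num.max (Num.max D r0) (`|s' - t| + 1).
  have [_ [rho [rho0 Hrho] <-]] : exists2 y,
      [set r%:E | r in curvature_radius T g p t] y & (b%:E < y)%E.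
    by apply: ereal_sup_gt; rewrite -/(scale_sup p t) supy ltry.
  rewrite lte_fin /b !gt_max => /andP[/andP[Drho r0rho] srho].
  apply: lt_trans (inv_sqr_lt r00 r0rho).
  apply/Hrho/parabolic_cylinderE; split => //.
    by apply: lt_trans pq' _; rewrite lte_fin.
  have := normr_ge0 (s' - t); nra.
apply/eqyP => A A0; apply: ereal_sup_ubound; exists A => //.
exact: good.
Qed.

(** The supremum may not be attained, so some [rho > 9/10 r] is used. The margins are
    [1/10 + 3/2 * 1/2 < 9/10] in space and [1/100 + 1/4 < 81/100] in time. *)
Lemma scale_sup_lower (p q : M) (t s a1 r : R) :
  0 < t -> (t%:E < T)%E -> 0 < s -> (s%:E < T)%E ->
  0 < a1 -> a1 <= 10^-1 -> n%:R * a1 <= 10^-1 -> 0 < r ->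
  (rdist (g t) p q < (a1 * r)%:E)%E -> `|s - t| < (a1 * r) ^+ 2 ->
  scale_sup p t = r%:E -> ((r / 2)%:E <= scale_sup q s)%E.
Proof.
move=> t0 tT s0 sT a10 a1le na1 r0 pq st supr.
apply: ereal_sup_ubound; exists (r / 2) => //; split; first by rewrite divr_gt0.
move=> q' s' /parabolic_cylinderE[qq' s's s'0 s'T].
have [_ [rho crho <-]] : exists2 y,
    [set r%:E | r in curvature_radius T g p t] y & ((9 / 10 * r)%:E < y)%E.
  by apply: ereal_sup_gt; rewrite -/(scale_sup p t) supr lte_fin; lra.
rewrite lte_fin => rrho; have [rho0 Hrho] := crho.
have a1r : (a1 * r) ^+ 2 <= 100^-1 * r ^+ 2.
  rewrite exprMn; apply: ler_wpM2r; [exact: sqr_ge0|nra].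
have n1r : (n%:R * a1) ^+ 2 <= 100^-1.
  have : 0 <= n%:R * a1 by rewrite mulr_ge0 // ltW.
  nra.
have rho2 : 81 / 100 * r ^+ 2 <= rho ^+ 2 by nra.
have r20 : 0 < r ^+ 2 by rewrite exprn_gt0.
have nst : 4 * n%:R ^+ 2 * `|s - t| <= rho ^+ 2.
  apply: (@le_trans _ _ (4 * n%:R ^+ 2 * (a1 * r) ^+ 2)).
    by apply: ler_wpM2l; [rewrite mulr_ge0 ?sqr_ge0|exact: ltW].
  have -> : 4 * n%:R ^+ 2 * (a1 * r) ^+ 2 = 4 * r ^+ 2 * (n%:R * a1) ^+ 2 by ring.
  nra.
have strho : `|s - t| < rho ^+ 2 by lra.
have sum_le : a1 * r + 3 / 2 * (r / 2) <= rho by nra.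
have pq' := ball_containment flow t0 tT s0 sT crho strho nst pq qq' sum_le.
apply: (@lt_trans _ _ (rho ^- 2)); last by apply: inv_sqr_lt; lra.
apply/Hrho/parabolic_cylinderE; split => //.
apply: le_lt_trans (ler_distD s s' t) _.
have : (r / 2) ^+ 2 = 4^-1 * r ^+ 2 by field.
lra.
Qed.

(** The margins are [1/100 + 3/2 * (1/10 + 6/5) < 2] in space and [1/100 + 36/25 < 4] in time; 6/5
    only has to exceed 1 and leave this room. *)
Lemma scale_sup_upper (p q : M) (t s a1 r : R) :
  0 < t -> (t%:E < T)%E -> 0 < s -> (s%:E < T)%E ->
  0 < a1 -> a1 <= 10^-1 -> n%:R * a1 <= 10^-1 -> 0 < r ->
  (rdist (g t) p q < (a1 * r)%:E)%E -> `|s - t| < (a1 * r) ^+ 2 ->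
  scale_sup p t = r%:E -> (scale_sup q s <= (2 * r)%:E)%E.
Proof.
move=> t0 tT s0 sT a10 a1le na1 r0 pq st supr.
have rt := flow_riemannian flow t0 tT.
rewrite leNgt; apply/negP => /ereal_sup_gt[_ [rho crho <-]].
rewrite lte_fin => rrho; have [rho0 Hrho] := crho.
have a1r : (a1 * r) ^+ 2 <= 100^-1 * r ^+ 2.
  rewrite exprMn; apply: ler_wpM2r; [exact: sqr_ge0|nra].
have n1r : (n%:R * a1) ^+ 2 <= 100^-1.
  have : 0 <= n%:R * a1 by rewrite mulr_ge0 // ltW.
  nra.
have rho2 : 4 * r ^+ 2 <= rho ^+ 2 by nra.
have r20 : 0 < r ^+ 2 by rewrite exprn_gt0.
have nst : 4 * n%:R ^+ 2 * `|t - s| <= rho ^+ 2.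
  rewrite distrC; apply: (@le_trans _ _ (4 * n%:R ^+ 2 * (a1 * r) ^+ 2)).
    by apply: ler_wpM2l; [rewrite mulr_ge0 ?sqr_ge0|exact: ltW].
  have -> : 4 * n%:R ^+ 2 * (a1 * r) ^+ 2 = 4 * r ^+ 2 * (n%:R * a1) ^+ 2 by ring.
  nra.
have tsrho : `|t - s| < rho ^+ 2 by rewrite distrC; lra.
(* The distance from [q] to itself enters [ball_containment] through a strict bound, so a small
   positive length is reserved for it. *)
have e0 : 0 < 100^-1 * r by rewrite mulr_gt0 // invr_gt0.
suff cr : curvature_radius T g p t (6 / 5 * r).
  have : ((6 / 5 * r)%:E <= scale_sup p t)%E.
    by apply: ereal_sup_ubound; exists (6 / 5 * r).
  rewrite supr lee_fin; lra.
split; first by lra.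
move=> q' s' /parabolic_cylinderE[pq' s't s'0 s'T].
have qp := rdist_sym_lt rt pq.
have qq' := rdist_triangle_lt rt qp (ltW pq').
have sum_le : 100^-1 * r + 3 / 2 * (a1 * r + 6 / 5 * r) <= rho by nra.
have sqq' := ball_containment flow s0 sT t0 tT crho tsrho nst
  (rdist_refl_lt g s q e0) qq' sum_le.
apply: (@lt_trans _ _ (rho ^- 2)); last by apply: inv_sqr_lt; lra.
apply/Hrho/parabolic_cylinderE; split => //.
apply: le_lt_trans (ler_distD t s' s) _; rewrite (distrC t s).
have : (6 / 5 * r) ^+ 2 = 36 / 25 * r ^+ 2 by field.
lra.
Qed.

End Scale.

Theorem corollary2p3 (R : realType) (n : nat) :
  exists a1 : R, 0 < a1 < 1 /\
    forall (M : manifold R n) (T : \bar R) (g : R -> metric_field M),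
      (0 < T)%E -> ricci_flow T g -> complete_flow T g ->
      forall (p : M) (t : R), 0 < t -> (t%:E < T)%E ->
      forall (q : M) (s : R),
        parabolic_cylinder T g p t (a1%:E * riemann_scale T g p t)%E (q, s) ->
        ((4^-1)%:E * (riemann_scale T g p t)^-1 ^+ 2
           <= (riemann_scale T g q s)^-1 ^+ 2
           <= 4%:E * (riemann_scale T g p t)^-1 ^+ 2)%E.
Proof.
(* The denominator [n.+1] makes both [a1] and [n * a1] at most 1/10. *)
pose a1 : R := 10^-1 / n.+1%:R.
have n1 : 1 <= n.+1%:R :> R by rewrite ler1n.
have a10 : 0 < a1 by rewrite divr_gt0 // invr_gt0.
have a1le : a1 <= 10^-1 by rewrite /a1 ler_pdivrMr ?ltr0n // ler_peMr // invr_ge0.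
have na1 : n%:R * a1 <= 10^-1.
  rewrite /a1 mulrCA -[leRHS]mulr1; apply: ler_wpM2l; first by rewrite invr_ge0.
  by rewrite ler_pdivrMr ?ltr0n // mul1r ler_nat.
exists a1; split; first by rewrite a10; lra.
move=> M T g _ flow _ p t t0 tT q s.
(* The inverse of [+oo] is 0, so all three members vanish when both scales are infinite. *)
have infty0 : ((4^-1)%:E * ((+oo : \bar R)^-1) ^+ 2 <= ((+oo : \bar R)^-1) ^+ 2
    <= 4%:E * ((+oo : \bar R)^-1) ^+ 2)%E.
  by rewrite invey expe2 !mule0 lexx.
(* Flatness concerns the whole flow, so the scales at both points fall in the same branch. *)
rewrite /riemann_scale; case: asboolP => [//|_].
rewrite -/(scale_sup T g p t) -/(scale_sup T g q s).
case E : (scale_sup T g p t) => [r| |].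
(* A supremum that is not positive makes the cylinder empty, since distances are nonnegative; the
   case [-oo] below is the same. *)
- have [r0|r0] := ltP 0 r; last first.
    move=> [/= + _]; rewrite ltNge => /negP[].
    by apply: le_trans (rdist_ge0 _ _ _); rewrite -EFinM lee_fin pmulr_rle0.
  rewrite -EFinM => /parabolic_cylinderE[pq st s0 sT].
  have := scale_sup_lower flow t0 tT s0 sT a10 a1le na1 r0 pq st E.
  have := scale_sup_upper flow t0 tT s0 sT a10 a1le na1 r0 pq st E.
  case: (scale_sup T g q s) => [r'| |] //; rewrite !lee_fin => r'2 r'1.
  have r'0 : 0 < r' by lra.
  rewrite !inver !gt_eqF // -!EFin_expe -!EFinM !lee_fin !exprVn.
  have r2 : 0 < r ^+ 2 by rewrite exprn_gt0.
  have r'2' : 0 < r' ^+ 2 by rewrite exprn_gt0.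
  rewrite -invfM lef_pV2 ?posrE ?mulr_gt0 //.
  apply/andP; split; first by nra.
  rewrite -[4]invrK -invfM lef_pV2 ?posrE ?mulr_gt0 ?invr_gt0 //; nra.
- rewrite gt0_muley ?lte_fin // => -[/= pq /andP[s0 sT]].
  move: s0 sT; rewrite gt_max lt_min !lte_fin => /andP[_ s0] /andP[_ sT].
  by rewrite (scale_sup_infinite flow t0 tT s0 sT pq E).
move=> [/= + _]; rewrite gt0_muleNy ?lte_fin // ltNge => /negP[].
exact: leNye.
Qed.
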